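(* Let $\Gamma$ be a finite index subgroup of $\mathrm{SL}_2(\mathbb{Z})\subset\mathrm{Out}(F_2)$. Then there exist a finite group $G$ and an exterior surjection $[\varphi]$, $\varphi:F_2\twoheadrightarrow G$, such that $\Gamma\supset\Gamma_{[\varphi]}:=\mathrm{Stab}_{\mathrm{SL}_2(\mathbb{Z})}([\varphi])$. In particular, for every modular curve $\mathcal{H}/\Gamma$ corresponding to a finite index subgroup $\Gamma\le\mathrm{SL}_2(\mathbb{Z})$, there exist a finite group $G$ and an exterior surjection $[\varphi]$, $\varphi:F_2\twoheadrightarrow G$, such that $\mathcal{H}/\Gamma$ is a quotient (by a finite group action) of $\mathcal{H}/\Gamma_{[\varphi]}$.
   Context: $\mathcal{H}$ is the complex upper half plane. $F_2$ is the free group on two generators. For a surjective homomorphism $\varphi:F_2\twoheadrightarrow G$ onto a finite group, $[\varphi]$ denotes its class in $\mathrm{Hom}^{\text{sur-ext}}(F_2,G):=\mathrm{Surj}(F_2,G)/\mathrm{Inn}(G)$, called an exterior surjection. The action on $F_2^{\mathrm{ab}}=\mathbb{Z}^2$ identifies $\mathrm{Out}(F_2)$ with $\mathrm{GL}_2(\mathbb{Z})$, and $\mathrm{SL}_2(\mathbb{Z})\subset\mathrm{GL}_2(\mathbb{Z})\cong\mathrm{Out}(F_2)$ acts on $\mathrm{Hom}^{\text{sur-ext}}(F_2,G)$ by precomposition; $\Gamma_{[\varphi]}$ is the stabilizer of $[\varphi]$. *)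

(* Defs.v *)
From HB Require Import structures.
From mathcomp Require Import all_boot all_order all_algebra all_fingroup.
From mathcomp Require Import complex ring generic_quotient.
From mathcomp Require Import all_classical all_reals all_analysis.

Set Implicit Arguments.
Unset Strict Implicit.
Unset Printing Implicit Defensive.

Import Order.TTheory GRing.Theory Num.Theory.
Import numFieldNormedType.Exports.

Local Open Scope classical_set_scope.
Local Open Scope ring_scope.
Local Open Scope quotient_scope.

(* The letter (i, false) stands for the generator x_i, (i, true) for its
   inverse; the elements of F2 are the reduced words in these letters. *)
Definition letter : Type := ('I_2 * bool)%type.

Definition linv (x : letter) : letter := (x.1, ~~ x.2).

Definition reduced (w : seq letter) : bool :=
  sorted (fun x y => y != linv x) w.

Definition push (x : letter) (w : seq letter) : seq letter :=
  if w is y :: w' then if y == linv x then w' else x :: w else [:: x].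

Definition reduce (w : seq letter) : seq letter := foldr push [::] w.

Lemma linvK : involutive linv.
Proof. by case=> i b; rewrite /linv /= negbK. Qed.

Lemma push_reduced x w : reduced w -> reduced (push x w).
Proof.
case: w => [//|y w] /= red_yw; case: ifP => [_|/negbT ne]; last first.
  by rewrite /reduced /= ne.
by case: w red_yw => [//|z w] /andP[].
Qed.

Lemma reduce_reduced w : reduced (reduce w).
Proof. by elim: w => //= x w IHw; exact: push_reduced. Qed.

Lemma reduced_tail x w : reduced (x :: w) -> reduced w.
Proof. by case: w => [//|y w] /andP[]. Qed.

Lemma push_id x w : reduced (x :: w) -> push x w = x :: w.
Proof. by case: w => [//|y w] /= /andP[/negbTE->]. Qed.

Lemma reduce_id w : reduced w -> reduce w = w.
Proof.
elim: w => //= x w IHw red_xw.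
by rewrite IHw ?push_id //; exact: reduced_tail red_xw.
Qed.

Lemma push_linvK x w : reduced w -> push x (push (linv x) w) = w.
Proof.
case: w => [|y w] red_w /=; first by rewrite eqxx.
rewrite linvK; case: eqP => [eq_yx|_]; last by rewrite /= eqxx.
by rewrite -eq_yx push_id.
Qed.

Lemma reduce_catr u v : reduce (u ++ reduce v) = reduce (u ++ v).
Proof.
by elim: u => [|x u IHu] /=; [rewrite reduce_id ?reduce_reduced | rewrite IHu].
Qed.

Lemma reduce_push_cat x u v : reduce (push x u ++ v) = push x (reduce (u ++ v)).
Proof.
case: u => [//|y u] /=; case: eqP => [->|_] //=.
by rewrite push_linvK ?reduce_reduced.
Qed.

Lemma reduce_catl u v : reduce (reduce u ++ v) = reduce (u ++ v).
Proof. by elim: u => [//|x u IHu] /=; rewrite reduce_push_cat IHu. Qed.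

Definition winv (w : seq letter) : seq letter := rev (map linv w).

Lemma reduce_winvl w : reduce (winv w ++ w) = [::].
Proof.
elim: w => [//|x w IHw]; rewrite /winv /= rev_cons cat_rcons /=.
have := push_linvK (linv x) (reduce_reduced w); rewrite linvK => pushK.
by rewrite -reduce_catr /= pushK reduce_catr.
Qed.

Lemma reduce_winvr w : reduce (w ++ winv w) = [::].
Proof.
have {1}-> : w = winv (winv w).
  by rewrite /winv map_rev revK mapK //; exact: linvK.
exact: reduce_winvl.
Qed.

Record F2 : Type := MkF2 { word : seq letter; _ : reduced word }.

HB.instance Definition _ := [isSub for word].
HB.instance Definition _ := [Choice of F2 by <:].

Lemma wordP (w : F2) : reduced (word w). Proof. exact: valP. Qed.

Definition mkF2 (w : seq letter) : F2 := MkF2 (reduce_reduced w).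
Definition F2_mul (u v : F2) : F2 := mkF2 (word u ++ word v).
Definition F2_inv (u : F2) : F2 := mkF2 (winv (word u)).

Fact F2_mulA : associative F2_mul.
Proof.
by move=> u v w; apply: val_inj; rewrite /= reduce_catr reduce_catl catA.
Qed.
Fact F2_mul1 : left_id (mkF2 [::]) F2_mul.
Proof. by move=> u; apply: val_inj; rewrite /= reduce_id ?wordP. Qed.
Fact F2_1mul : right_id (mkF2 [::]) F2_mul.
Proof. by move=> u; apply: val_inj; rewrite /= cats0 reduce_id ?wordP. Qed.
Fact F2_mulV : left_inverse (mkF2 [::]) F2_inv F2_mul.
Proof.
by move=> u; apply: val_inj; rewrite /= reduce_catl reduce_winvl.
Qed.
Fact F2_Vmul : right_inverse (mkF2 [::]) F2_inv F2_mul.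
Proof.
by move=> u; apply: val_inj; rewrite /= reduce_catr reduce_winvr.
Qed.
HB.instance Definition _ :=
  isGroup.Build F2 F2_mulA F2_mul1 F2_1mul F2_mulV F2_Vmul.

Definition gen (i : 'I_2) : F2 := mkF2 [:: (i, false)].

(* w |-> (expo 0 w, expo 1 w) is the abelianization map F2 -> Z^2. *)
Definition expo_word (i : 'I_2) (w : seq letter) : int :=
  \sum_(x <- w | x.1 == i) (-1) ^+ x.2.

Definition expo (i : 'I_2) (w : F2) : int := expo_word i (word w).

Lemma expo_push i x w : expo_word i (push x w) = expo_word i (x :: w).
Proof.
case: w => [//|y w] /=; case: eqP => [->|//]; rewrite /expo_word !big_cons /=.
by case: x => j b /=; case: (j == i) => //; case: b => /=; ring.
Qed.

Lemma expo_reduce i w : expo_word i (reduce w) = expo_word i w.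
Proof.
elim: w => [//|x w IHw]; rewrite /= expo_push /expo_word !big_cons.
by move: IHw; rewrite /expo_word => ->.
Qed.

Lemma expoM i (u v : F2) : expo i (u * v)%g = expo i u + expo i v.
Proof. by rewrite /expo /= expo_reduce /expo_word big_cat. Qed.

Lemma expo_gen i j : expo i (gen j) = (i == j)%:R.
Proof.
rewrite /expo /expo_word /= big_cons big_nil /= eq_sym.
by case: (i == j).
Qed.

Lemma additive_expo (h : F2 -> int) :
  {morph h : u v / (u * v)%g >-> u + v} ->
  forall w, h w = \sum_k h (gen k) * expo k w.
Proof.
move=> hM.
have h1 : h 1%g = 0 by apply: (addrI (h 1%g)); rewrite -hM mulg1 addr0.
have hV u : h (u^-1)%g = - h u.
  by apply: (addrI (h u)); rewrite -hM mulgV h1 subrr.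
have hlet i b : h (mkF2 [:: (i, b)]) = h (gen i) * (-1) ^+ b.
  case: b; last by rewrite mulr1.
  rewrite mulrN1 -hV; congr h; exact: val_inj.
case=> w; elim: w => [|[i b] w IHw] red_w.
  rewrite [X in h X](_ : _ = 1%g) ?h1; last exact: val_inj.
  by rewrite big1 // => k _; rewrite /expo /expo_word big_nil mulr0.
have red_w' := reduced_tail red_w.
have -> : MkF2 red_w = (mkF2 [:: (i, b)] * MkF2 red_w')%g.
  apply: val_inj; rewrite /= -[RHS]/(reduce ((i, b) :: w)).
  by rewrite reduce_id.
rewrite hM IHw hlet; under [RHS]eq_bigr => k _ do rewrite expoM mulrDr.
rewrite big_split /=; congr (_ + _).
rewrite (bigD1 i) //= big1 ?addr0; last first.
  move=> k ne_ki; rewrite /expo /expo_word /= big_cons big_nil /=.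
  by rewrite eq_sym (negbTE ne_ki) mulr0.
by rewrite /expo /expo_word /= big_cons big_nil /= eqxx addr0.
Qed.

Record autF2 : Type := AutF2 {
  aut_fun :> {multiplicative F2 -> F2};
  aut_bij : bijective aut_fun }.

HB.instance Definition _ := gen_eqMixin autF2.
HB.instance Definition _ := gen_choiceMixin autF2.

Fact idfun_bij (T : Type) : bijective (@idfun T).
Proof. by exists idfun. Qed.

Definition aut_id : autF2 :=
  @AutF2 (idfun : {multiplicative F2 -> F2}) (idfun_bij F2).

Fact aut_comp_bij (a b : autF2) : bijective (a \o b).
Proof. exact: bij_comp (aut_bij a) (aut_bij b). Qed.

Definition aut_comp (a b : autF2) : autF2 :=
  @AutF2 ((a \o b) : {multiplicative F2 -> F2}) (aut_comp_bij a b).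

Lemma aut_has_inv (a : autF2) :
  exists b : autF2, cancel a b /\ cancel b a.
Proof.
have [f fK Kf] := aut_bij a.
pose F := isMultiplicative.Build F2 F2 f (can2_gmulfM fK Kf).
pose f' : {multiplicative F2 -> F2} := HB.pack f F.
have bij_f' : bijective f' by exists a.
by exists (AutF2 bij_f').
Qed.

(* The action of a on F2^ab = Z^2 (column vectors). *)
Definition ab_mx (a : autF2) : 'M[int]_2 :=
  \matrix_(i, j) expo i (a (gen j)).

Lemma ab_mx_comp a b : ab_mx (aut_comp a b) = ab_mx a *m ab_mx b.
Proof.
apply/matrixP => i j; rewrite !mxE /=.
rewrite (additive_expo (h := fun w => expo i (a w))); last first.
  by move=> u v; rewrite gmulfM expoM.
by apply: eq_bigr => k _; rewrite !mxE.
Qed.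

Lemma ab_mx_id : ab_mx aut_id = 1%:M.
Proof. by apply/matrixP => i j; rewrite !mxE /= expo_gen. Qed.

Lemma morph_conj (G H : groupType) (f : {multiplicative G -> H}) (x y : G) :
  f (x^-1 * y * x)%g = ((f x)^-1 * f y * f x)%g.
Proof.
have f1 : f 1%g = 1%g by apply: (mulgI (f 1%g)); rewrite -gmulfM !mulg1.
have fV : f (x^-1)%g = ((f x)^-1)%g.
  by apply: (mulgI (f x)); rewrite -gmulfM !mulgV f1.
by rewrite !gmulfM fV.
Qed.

Lemma conj_equiv_class (T I : Type) (G : groupType) (ev : T -> I -> G) :
  equiv_class_of
    (fun a b => `[< exists x : G, forall i, ev b i = (x^-1 * ev a i * x)%g >]).
Proof.
have sym a b : (exists x : G, forall i, ev b i = (x^-1 * ev a i * x)%g) ->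
    exists x : G, forall i, ev a i = (x^-1 * ev b i * x)%g.
  by move=> [x hx]; exists x^-1%g => i; rewrite hx invgK !mulgA mulgV mul1g mulgK.
split=> [a|a b|b a c].
- by apply/asboolP; exists 1%g => i; rewrite invg1 mul1g mulg1.
- by apply: asbool_equiv_eq; split; exact: sym.
- move=> /asboolP[x hx] /asboolP[y hy]; apply/asboolP; exists (x * y)%g => i.
  by rewrite hy hx invgM !mulgA.
Qed.

(* Out(F2) = Aut(F2) / Inn(F2). *)
Definition inn_eqv (a b : autF2) : bool :=
  `[< exists u : F2, forall w, b w = (u^-1 * a w * u)%g >].

Canonical inn_eqv_rel := @EquivRelPack _ inn_eqv
  (conj_equiv_class (fun (a : autF2) w => a w)).

Definition outF2 : Type := {eq_quot inn_eqv}.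
HB.instance Definition _ := Quotient.on outF2.
HB.instance Definition _ := Choice.on outF2.

Definition out_class (a : autF2) : outF2 := \pi a.

Lemma out_classP (a b : autF2) : out_class a = out_class b <->
  exists u : F2, forall w, b w = (u^-1 * a w * u)%g.
Proof.
split=> [eq_ab | /asboolP eqv_ab]; last exact/(@eqmodP _ inn_eqv_rel).
exact/asboolP/(@eqmodP _ inn_eqv_rel).
Qed.

Definition ab_out (o : outF2) : 'M[int]_2 := ab_mx (repr o).

Lemma ab_outE (a : autF2) : ab_out (out_class a) = ab_mx a.
Proof.
have /out_classP[u hu] : out_class (repr (out_class a)) = out_class a.
  exact: reprK.
apply/matrixP=> i j; rewrite !mxE hu !expoM addrAC -expoM mulVg.
by rewrite /expo /expo_word /= big_nil add0r.
Qed.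

Record surjF2 (G : groupType) : Type := SurjF2 {
  surj_fun :> {multiplicative F2 -> G};
  surj_onto : forall g : G, exists w : F2, surj_fun w = g }.

HB.instance Definition _ (G : groupType) := gen_eqMixin (surjF2 G).
HB.instance Definition _ (G : groupType) := gen_choiceMixin (surjF2 G).

Section ExteriorSurjections.
Variable G : groupType.

Definition conj_eqv (f g : surjF2 G) : bool :=
  `[< exists x : G, forall w, g w = (x^-1 * f w * x)%g >].

Canonical conj_eqv_rel := @EquivRelPack _ conj_eqv
  (conj_equiv_class (fun (f : surjF2 G) w => f w)).

Definition ext_surj : Type := {eq_quot conj_eqv}.
HB.instance Definition _ := Quotient.on ext_surj.
HB.instance Definition _ := Choice.on ext_surj.

Definition ext_class (f : surjF2 G) : ext_surj := \pi f.

Lemma ext_classP (f g : surjF2 G) : ext_class f = ext_class g <->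
  exists x : G, forall w, g w = (x^-1 * f w * x)%g.
Proof.
split=> [eq_fg | /asboolP eqv_fg]; last exact/(@eqmodP _ conj_eqv_rel).
exact/asboolP/(@eqmodP _ conj_eqv_rel).
Qed.

Fact precomp_onto (f : surjF2 G) (a : autF2) (g : G) :
  exists w : F2, (f \o a) w = g.
Proof.
have [w <-] := surj_onto f g; have [b _ bK] := aut_bij a.
by exists (b w); rewrite /= bK.
Qed.

Definition precomp (f : surjF2 G) (a : autF2) : surjF2 G :=
  @SurjF2 G ((f \o a) : {multiplicative F2 -> G}) (precomp_onto f a).

(* The right action of Out(F2) by precomposition. *)
Definition out_act (c : ext_surj) (o : outF2) : ext_surj :=
  ext_class (precomp (repr c) (repr o)).

Lemma out_actE (f : surjF2 G) (a : autF2) :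
  out_act (ext_class f) (out_class a) = ext_class (precomp f a).
Proof.
have /out_classP[u hu] : out_class (repr (out_class a)) = out_class a.
  exact: reprK.
have /ext_classP[x hx] : ext_class (repr (ext_class f)) = ext_class f.
  exact: reprK.
apply/ext_classP; exists (repr (ext_class f) u * x)%g => w /=.
by rewrite hx hu morph_conj invgM !mulgA.
Qed.

End ExteriorSurjections.

Fact SL2Z_1_subproof : \det (1%:M : 'M[int]_2) == 1.
Proof. by rewrite det1. Qed.

Record SL2Z : Type := MkSL2Z { SL2Z_mx :> 'M[int]_2; _ : \det SL2Z_mx == 1 }.

HB.instance Definition _ := [isSub for SL2Z_mx].
HB.instance Definition _ := [Choice of SL2Z by <:].

Lemma SL2Z_det (g : SL2Z) : \det (SL2Z_mx g) = 1.
Proof. exact/eqP/(valP g). Qed.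

Lemma SL2Z_unit (g : SL2Z) : SL2Z_mx g \in unitmx.
Proof. by rewrite unitmxE SL2Z_det unitr1. Qed.

Fact SL2Z_mul_subproof (g h : SL2Z) : \det (SL2Z_mx g *m SL2Z_mx h) == 1.
Proof. by rewrite det_mulmx !SL2Z_det mulr1. Qed.
Fact SL2Z_inv_subproof (g : SL2Z) : \det (invmx (SL2Z_mx g)) == 1.
Proof. by rewrite det_inv SL2Z_det invr1. Qed.

Definition SL2Z_one : SL2Z := MkSL2Z SL2Z_1_subproof.
Definition SL2Z_mul (g h : SL2Z) : SL2Z := MkSL2Z (SL2Z_mul_subproof g h).
Definition SL2Z_inv (g : SL2Z) : SL2Z := MkSL2Z (SL2Z_inv_subproof g).

Fact SL2Z_mulA : associative SL2Z_mul.
Proof. by move=> g h k; apply: val_inj; exact: mulmxA. Qed.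
Fact SL2Z_mul1 : left_id SL2Z_one SL2Z_mul.
Proof. by move=> g; apply: val_inj; exact: mul1mx. Qed.
Fact SL2Z_1mul : right_id SL2Z_one SL2Z_mul.
Proof. by move=> g; apply: val_inj; exact: mulmx1. Qed.
Fact SL2Z_mulV : left_inverse SL2Z_one SL2Z_inv SL2Z_mul.
Proof. by move=> g; apply: val_inj; exact: mulVmx (SL2Z_unit g). Qed.
Fact SL2Z_Vmul : right_inverse SL2Z_one SL2Z_inv SL2Z_mul.
Proof. by move=> g; apply: val_inj; exact: mulmxV (SL2Z_unit g). Qed.
HB.instance Definition _ :=
  isGroup.Build SL2Z SL2Z_mulA SL2Z_mul1 SL2Z_1mul SL2Z_mulV SL2Z_Vmul.

Definition left_coset (G : groupType) (S : {pred G}) (g : G) : set G :=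
  [set h | (g^-1 * h)%g \in S].

Definition finite_index (G : groupType) (S : groupClosed G) : Prop :=
  finite_set (range (left_coset S)).

(* ab_out identifies Out(F2) with GL_2(Z), so the element of Out(F2)
   corresponding to g is the outer class o with ab_out o = g. *)
Definition ext_stab (G : groupType) (c : ext_surj G) : {pred SL2Z} :=
  fun g => `[< exists2 o : outF2, ab_out o = SL2Z_mx g & out_act c o = c >].

Lemma ext_stabP (G : groupType) (f : surjF2 G) (g : SL2Z) :
  reflect (exists2 a : autF2, ab_mx a = SL2Z_mx g &
             exists x : G, forall w, f (a w) = (x^-1 * f w * x)%g)
          (g \in ext_stab (ext_class f)).
Proof.
apply: (iffP (asboolP _)) => [[q abq actq]|[a aba [x hx]]].
  have qE : out_class (repr q) = q by exact: reprK.
  exists (repr q); first exact: abq.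
  by move: actq; rewrite -{1}qE out_actE => /esym/ext_classP.
exists (out_class a); first by rewrite ab_outE.
by rewrite out_actE; apply/esym/ext_classP; exists x.
Qed.

Section Stabilizer.
Variables (G : groupType) (c : ext_surj G).

Let ext_reprK : ext_class (repr c) = c. Proof. exact: reprK. Qed.

Fact ext_stabM : mulg_closed (ext_stab c).
Proof.
rewrite -ext_reprK => g h /ext_stabP[a aba [x hx]] /ext_stabP[b abb [y hy]].
apply/ext_stabP; exists (aut_comp a b); first by rewrite ab_mx_comp aba abb.
by exists (y * x)%g => w; rewrite /= hx hy invgM !mulgA.
Qed.

Fact ext_stab1 : 1%g \in ext_stab c.
Proof.
rewrite -ext_reprK; apply/ext_stabP; exists aut_id; first exact: ab_mx_id.
by exists 1%g => w; rewrite invg1 mul1g mulg1.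
Qed.

Fact ext_stabV : invg_closed (ext_stab c).
Proof.
rewrite -ext_reprK => g /ext_stabP[a aba [x hx]].
have [b [aK bK]] := aut_has_inv a.
have abab : ab_mx a *m ab_mx b = 1%:M.
  rewrite -ab_mx_comp -ab_mx_id; apply/matrixP => i j; rewrite !mxE /=.
  by rewrite bK.
apply/ext_stabP; exists b.
  by rewrite -[RHS]mulmx1 -abab aba mulKmx ?SL2Z_unit.
by exists x^-1%g => w; rewrite -{2}[w]bK hx invgK !mulgA mulgV mul1g mulgK.
Qed.

HB.instance Definition _ := isMulClosed.Build SL2Z (ext_stab c) ext_stabM.
HB.instance Definition _ := isMul1Closed.Build SL2Z (ext_stab c) ext_stab1.
HB.instance Definition _ := isInvClosed.Build SL2Z (ext_stab c) ext_stabV.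

End Stabilizer.

Section UpperHalfPlane.
Variable R : realType.

(* The alias ^o carries the topology and the normed module structure over
   R[i], so that derivability is complex derivability. *)
Local Notation C := ((R[i])^o).

Definition upper_half_plane : set C := [set z | 0 < complex.Im z].

Definition UHP : Type := set_type upper_half_plane.
HB.instance Definition _ := Topological.on UHP.
HB.instance Definition _ := Choice.on UHP.

Definition mobius_num (g : SL2Z) (z : R[i]) : R[i] :=
  (SL2Z_mx g 0 0)%:~R * z + (SL2Z_mx g 0 1)%:~R.
Definition mobius_den (g : SL2Z) (z : R[i]) : R[i] :=
  (SL2Z_mx g 1 0)%:~R * z + (SL2Z_mx g 1 1)%:~R.

Lemma SL2Z_det2 (g : SL2Z) :
  SL2Z_mx g 0 0 * SL2Z_mx g 1 1 - SL2Z_mx g 0 1 * SL2Z_mx g 1 0 = 1.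
Proof.
rewrite -(SL2Z_det g) (expand_det_row _ 0) !big_ord_recl big_ord0 addr0.
rewrite /cofactor !det_mx11 !mxE /= expr0 expr1 mul1r mulN1r mulrN.
by congr (_ * _ - _ * _); congr (SL2Z_mx g _ _); apply: val_inj.
Qed.

Lemma intrC (m : int) : m%:~R = (m%:~R)%:C%C :> R[i].
Proof. by rewrite rmorph_int. Qed.

Lemma UHP_im (z : UHP) : 0 < complex.Im (val z : R[i]).
Proof. by have := valP z; rewrite inE. Qed.

Lemma mobius_den_neq0 (g : SL2Z) (z : R[i]) :
  0 < complex.Im z -> mobius_den g z != 0.
Proof.
case: z => x y /= y0; rewrite /mobius_den !intrC eq_complex /=.
rewrite !mul0r !addr0 subr0.
have := SL2Z_det2 g.
case: (eqVneq (SL2Z_mx g 1 0) 0) => [-> | c0] detg.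
  move: detg; rewrite mulr0 subr0 => detg.
  rewrite mul0r add0r mul0r eqxx andbT intr_eq0; apply/eqP => d0.
  by move: detg; rewrite d0 mulr0.
apply/negP => /andP[_]; rewrite mulf_eq0 intr_eq0 (negbTE c0) /=.
by rewrite gt_eqF.
Qed.

Lemma mobius_im_gt0 (g : SL2Z) (z : R[i]) : 0 < complex.Im z ->
  0 < complex.Im (mobius_num g z / mobius_den g z).
Proof.
move=> z0; have := mobius_den_neq0 g z0.
case: z z0 => x y /= y0; rewrite /mobius_den /mobius_num !intrC.
have := congr1 (fun m : int => m%:~R : R) (SL2Z_det2 g).
rewrite rmorphB !rmorphM /=.
set a := (_ 0 0)%:~R; set b := (_ 0 1)%:~R.
set c := (_ 1 0)%:~R; set d := (_ 1 1)%:~R => detg.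
rewrite eq_complex /= !mul0r !addr0 !subr0 => ne0.
have N0 : 0 < (c * x + d) ^+ 2 + (c * y) ^+ 2.
  rewrite lt_neqAle addr_ge0 ?sqr_ge0 // andbT eq_sym.
  by rewrite paddr_eq0 ?sqr_ge0 // !sqrf_eq0.
set N := _ + _ in N0 *.
rewrite (_ : _ + _ = (a * d - b * c) * y / N); last first.
  by rewrite /N; field; rewrite gt_eqF.
by rewrite detg mul1r divr_gt0.
Qed.

Definition mobius (g : SL2Z) (z : UHP) : UHP :=
  exist _ (mobius_num g (val z) / mobius_den g (val z))
    (mem_set (mobius_im_gt0 g (UHP_im z))).

Lemma val_mobius (g : SL2Z) (z : UHP) :
  val (mobius g z) = mobius_num g (val z) / mobius_den g (val z).
Proof. by []. Qed.

Lemma mobius1 (z : UHP) : mobius 1%g z = z.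
Proof.
apply: val_inj; rewrite val_mobius /mobius_num /mobius_den /= !mxE /=.
by rewrite mul1r mul0r addr0 add0r divr1.
Qed.

Lemma mobiusM (g h : SL2Z) (z : UHP) :
  mobius (g * h)%g z = mobius g (mobius h z).
Proof.
apply: val_inj; rewrite !val_mobius.
have := mobius_den_neq0 g (UHP_im (mobius h z)).
have := mobius_den_neq0 h (UHP_im z).
rewrite val_mobius /mobius_num /mobius_den /=.
set w := (val z : R[i]).
rewrite !mxE !big_ord_recl !big_ord0 !addr0 !rmorphD !rmorphM /=.
have -> : lift ord0 ord0 = 1 :> 'I_2 by exact: val_inj.
have -> : ord0 = 0 :> 'I_2 by exact: val_inj.
set p := (_%:~R * w + (h 0 1)%:~R); set q := (_%:~R * w + (h 1 1)%:~R).
set a := (g 0 0)%:~R; set b := (g 0 1)%:~R.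
set c := (g 1 0)%:~R; set d := (g 1 1)%:~R => q0 e0.
have e1 : c * p + d * q != 0.
  rewrite (_ : _ + _ = q * (c * (p / q) + d)); first by rewrite mulf_neq0.
  by field.
rewrite [X in X / _](_ : _ = a * p + b * q); last by rewrite /p /q; ring.
rewrite [X in _ / X](_ : _ = c * p + d * q); last by rewrite /p /q; ring.
by field; rewrite q0.
Qed.

(* Complex differentiability at z; since the upper half plane is open, the
   values of the extension by 0 outside of it play no role. *)
Definition holomorphic_at (F : UHP -> C) (z : UHP) : Prop :=
  derivable (valL_ (0 : C) F : C -> C) (val z) 1.

Section ModularCurve.
Variable S : groupClosed SL2Z.

Definition orbit_eqv (z w : UHP) : bool :=
  `[< exists2 g : SL2Z, g \in S & w = mobius g z >].

Fact orbit_eqv_equiv : equiv_class_of orbit_eqv.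
Proof.
have sym z w : (exists2 g : SL2Z, g \in S & w = mobius g z) ->
    exists2 g : SL2Z, g \in S & z = mobius g w.
  move=> [g gS ->]; exists g^-1%g; first by rewrite gpredV.
  by rewrite -mobiusM mulVg mobius1.
split=> [z|z w|w z v].
- by apply/asboolP; exists 1%g; [exact: gpred1 | rewrite mobius1].
- by apply: asbool_equiv_eq; split; exact: sym.
- move=> /asboolP[g gS ->] /asboolP[h hS ->]; apply/asboolP.
  by exists (h * g)%g; [exact: gpredM | rewrite mobiusM].
Qed.

Canonical orbit_eqv_rel := EquivRelPack orbit_eqv_equiv.

Definition curve_points : Type := quotient_topology {eq_quot orbit_eqv}.
HB.instance Definition _ := Topological.on curve_points.

Definition curve_proj (z : UHP) : curve_points := \pi_({eq_quot orbit_eqv}) z.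

Lemma curve_projP (z w : UHP) : curve_proj z = curve_proj w <->
  exists2 g : SL2Z, g \in S & w = mobius g z.
Proof.
split=> [eq_zw | /asboolP eqv_zw]; last exact/(@eqmodP _ orbit_eqv_rel).
exact/asboolP/(@eqmodP _ orbit_eqv_rel).
Qed.

End ModularCurve.

(* A topological space with a sheaf of C-valued functions: hol U f means that
   the restriction of f to the open set U is a section over U. *)
Record funspace : Type := FunSpace {
  space :> topologicalType;
  hol : set space -> (space -> C) -> Prop }.

Definition modular_curve (S : groupClosed SL2Z) : funspace :=
  @FunSpace (curve_points S) (fun U f =>
    forall z : UHP, U (curve_proj S z) ->
      holomorphic_at (f \o curve_proj S) z).

Definition holomorphic_map (X Y : funspace) (f : X -> Y) : Prop :=
  continuous f /\
  forall (V : set Y) (u : Y -> C), open V -> hol V u ->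
    hol (f @^-1` V) (u \o f).

(* p : X -> Y identifies Y with the quotient of X by a finite group acting by
   holomorphic automorphisms: the fibres of p are the orbits, Y has the
   quotient topology, and the functions on Y are the invariant ones on X. *)
Definition finite_group_quotient (X Y : funspace) (p : X -> Y) : Prop :=
  exists (Q : finGroupType) (act : {action Q &-> X}),
    [/\ forall q : Q, holomorphic_map (fun x : X => act x q),
        forall y : Y, exists x : X, p x = y,
        forall x x' : X, p x = p x' <-> exists q : Q, act x q = x',
        forall V : set Y, open V <-> open (p @^-1` V) &
        forall (V : set Y) (u : Y -> C), open V ->
          (hol V u <-> hol (p @^-1` V) (u \o p))].

End UpperHalfPlane.

(* Main.v *)
(* Write F2 = <x, y>, the fundamental group of a once-punctured torus E - 0.
   By Nielsen reduction, every automorphism of F2 acting trivially on Z^2 / 4 is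
   inner composed with a product of two squared Dehn twists, whose classes
   generate the Sanov subgroup of SL2(Z).

   Such twists move one branch point of E -> P^1 around the two others.  The
   kernel K of F2 -> (Z/2)^2 is the fundamental group of E - E[2], and embeds in
   the free group <a, c, b> of the sphere minus the four branch points, on which
   the twists act as pure braids: modulo c they fix a and b, and they conjugate
   c by a lift of the twist, read as a word in a and b.  So send a and b to
   generators of a finite group P on which the cosets of Gamma are visible and c
   to an element of Z/3 wr P that records a point of P.  If a twist becomes inner
   on the resulting finite quotient of F2, then following the loop c shows that
   its word has a central image in P, and P is chosen so that the word then
   acts trivially on the cosets of Gamma.

   For the second half, replace the finite quotient of F2 by the image of F2
   under the product of all homomorphisms to the same group.  The stabilizer N
   is then normal in SL2(Z), and Gamma / N acts on H / N. *)

Require Import Defs.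
From HB Require Import structures.
From mathcomp Require Import all_boot all_order all_algebra all_fingroup.
From mathcomp Require Import complex.
From mathcomp Require Import finmap.
From mathcomp Require Import all_classical all_reals all_analysis.
From mathcomp Require Import zify ring lra.

Set Implicit Arguments.
Unset Strict Implicit.
Unset Printing Implicit Defensive.

Import Order.TTheory GRing.Theory Num.Theory.
Import numFieldNormedType.Exports.

Local Open Scope group_scope.

Local Notation X := (gen ord0).
Local Notation Y := (gen ord_max).

(** * The free group of rank two *)

Lemma ord2P (i : 'I_2) : i = ord0 \/ i = ord_max.
Proof. by case: i => [[|[|]]] // ?; [left|right]; apply: val_inj. Qed.

Section Morphisms.
Variables (G H : groupType) (f : {multiplicative G -> H}).

Lemma mulf1 : f 1 = 1.
Proof. by apply: (mulgI (f 1)); rewrite -gmulfM !mulg1. Qed.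

Lemma mulfV : {morph f : x / x^-1}.
Proof. by move=> x; apply: (mulgI (f x)); rewrite -gmulfM !mulgV mulf1. Qed.

Lemma mulfJ : {morph f : x y / x ^ y}.
Proof. by move=> x y; rewrite !conjgE !gmulfM mulfV. Qed.

End Morphisms.

Definition conj_by (G : groupType) (g x : G) : G := x ^ g.

HB.instance Definition _ (G : groupType) (g : G) :=
  isMultiplicative.Build G G (conj_by g) (fun x y => conjMg x y g).

Section Evaluation.
Variable G : groupType.

Definition ev_letter (u v : G) (l : letter) : G :=
  let g := if l.1 == ord0 then u else v in if l.2 then g^-1 else g.

Definition ev_word (u v : G) (w : seq letter) : G :=
  foldr (fun l g => ev_letter u v l * g) 1 w.

(** The homomorphism given by the universal property of the free group: [X] goes to [u] and [Y] to
    [v]. *)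
Definition ev (u v : G) (w : F2) : G := ev_word u v (word w).

Lemma ev_linv u v l : ev_letter u v (linv l) = (ev_letter u v l)^-1.
Proof. by case: l => i [] //=; rewrite /ev_letter /= invgK. Qed.

Lemma ev_word_push u v l w : ev_word u v (push l w) = ev_word u v (l :: w).
Proof.
case: w => [//|k w] /=; case: eqP => [->|//] /=.
by rewrite ev_linv mulVKg.
Qed.

Lemma ev_word_reduce u v w : ev_word u v (reduce w) = ev_word u v w.
Proof. by elim: w => [//|l w IHw]; rewrite /= ev_word_push /= IHw. Qed.

Lemma ev_word_cat u v w1 w2 :
  ev_word u v (w1 ++ w2) = ev_word u v w1 * ev_word u v w2.
Proof. by elim: w1 => [|l w1 IHw] /=; rewrite ?mul1g // IHw mulgA. Qed.

Lemma evM u v : {morph ev u v : w1 w2 / w1 * w2}.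
Proof. by move=> w1 w2; rewrite /ev /= ev_word_reduce ev_word_cat. Qed.

HB.instance Definition _ u v := isMultiplicative.Build F2 G (ev u v) (evM u v).

Lemma evV u v : {morph ev u v : w / w^-1}.
Proof. exact: (mulfV (ev u v)). Qed.

Lemma evX u v : ev u v X = u. Proof. exact: mulg1. Qed.
Lemma evY u v : ev u v Y = v. Proof. exact: mulg1. Qed.

Lemma mkF2_cons l w : mkF2 (l :: w) = mkF2 [:: l] * mkF2 w.
Proof.
by apply: val_inj; rewrite /= -[RHS]/(push l (reduce (reduce w)))
  (reduce_id (reduce_reduced w)).
Qed.

Lemma mkF2_word w : mkF2 (word w) = w.
Proof. by apply: val_inj; rewrite /= reduce_id // wordP. Qed.

Lemma hom_ev (f : {multiplicative F2 -> G}) w : f w = ev (f X) (f Y) w.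
Proof.
rewrite -{1}[w]mkF2_word /ev; elim: (word w) => [|l s IHs].
  by have -> : mkF2 [::] = 1 by []; rewrite mulf1.
rewrite mkF2_cons gmulfM IHs /=; congr (_ * _).
case: l => i b; rewrite /ev_letter /=.
have -> : mkF2 [:: (i, b)] = if b then (gen i)^-1 else gen i.
  by case: b; apply: val_inj.
by case: (ord2P i) => -> /=; case: b; rewrite ?mulfV.
Qed.

Lemma hom_ext (f g : {multiplicative F2 -> G}) :
  f X = g X -> f Y = g Y -> f =1 g.
Proof. by move=> fgX fgY w; rewrite hom_ev fgX fgY -hom_ev. Qed.

End Evaluation.

Lemma gmulf_ev (G H : groupType) (f : {multiplicative G -> H}) (u v : G) w :
  f (ev u v w) = ev (f u) (f v) w.
Proof.
have := hom_ext (f := f \o ev u v) (g := ev (f u) (f v)).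
by rewrite /= !evX !evY => /(_ erefl erefl w).
Qed.

(** * Common prefixes and lengths *)

Fixpoint lcp (p q : seq letter) : nat :=
  match p, q with
  | x :: p', y :: q' => if x == y then (lcp p' q').+1 else 0
  | _, _ => 0
  end.

Lemma lcpC p q : lcp p q = lcp q p.
Proof. by elim: p q => [|x p IHp] [|y q] //=; rewrite eq_sym IHp. Qed.

Lemma lcp_leq p q : (lcp p q <= size p)%N.
Proof. by elim: p q => [|x p IHp] [|y q] //=; case: ifP => // _; exact: IHp. Qed.

Lemma lcp_refl p : lcp p p = size p.
Proof. by elim: p => [//|x p IHp] /=; rewrite eqxx IHp. Qed.

Lemma lcp_ultra q p r : (minn (lcp p q) (lcp q r) <= lcp p r)%N.
Proof.
elim: p q r => [|x p IHp] [|y q] [|z r] //=; rewrite ?minn0 ?min0n //.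
case: eqP => [->|_]; last by rewrite min0n.
by case: eqP => [_|_]; rewrite ?minn0 // minnSS ltnS; exact: IHp.
Qed.

Lemma lcp_take k q : (k <= size q)%N -> lcp (take k q) q = k.
Proof.
elim: q k => [|x q IHq] [|k] //=; rewrite ?ltnS ?eqxx // => le_kq.
by rewrite IHq.
Qed.

Lemma lcp_nth p q i x0 : (i < lcp p q)%N -> nth x0 p i = nth x0 q i.
Proof.
elim: p q i => [|x p IHp] [|y q] i //=; case: eqP => [->|_] //.
by case: i => [//|i]; rewrite ltnS => /IHp.
Qed.

Lemma reduced_cat s a q :
  reduced (rcons s a) -> reduced (a :: q) -> reduced (rcons s a ++ q).
Proof.
rewrite /reduced; case: s => [//|x s] /= sa aq.
by rewrite cat_path sa last_rcons.
Qed.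

Lemma reduced_winv p : reduced p -> reduced (winv p).
Proof.
rewrite /reduced /winv rev_sorted sorted_map.
apply: sub_sorted => x y; apply: contraNneq => /= eq_xy.
by rewrite eq_xy linvK.
Qed.

Lemma size_reduce_winv p q : reduced p -> reduced q ->
  (size (reduce (winv p ++ q)) + 2 * lcp p q = size p + size q)%N.
Proof.
elim: p q => [|x p IHp] [|y q] red_p red_q.
- by [].
- by rewrite cat0s reduce_id //= addn0.
- by rewrite cats0 reduce_id ?reduced_winv //= size_rev size_map !addn0.
rewrite /winv /= rev_cons -/(winv p).
case: eqP => [eq_xy|/eqP ne_xy].
  have redq := reduced_tail red_q.
  have pushK : push (linv x) (push x q) = q.
    by rewrite -{2}[x]linvK push_linvK.
  rewrite cat_rcons -eq_xy -reduce_catr /= (reduce_id redq) pushK.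
  by have := IHp q (reduced_tail red_p) redq; lia.
rewrite reduce_id; first by rewrite size_cat size_rcons size_rev size_map /=; lia.
apply: reduced_cat; last by rewrite /reduced /= linvK eq_sym ne_xy.
by move: (reduced_winv red_p); rewrite /winv /= rev_cons.
Qed.

(** If [winv q] and [q] agreed on at least half of their length, the middle letter of [q] would be
    its own inverse (odd length), or its two middle letters would cancel (even length). *)
Lemma lcp_winv q : reduced q -> (0 < size q)%N ->
  (2 * lcp (winv q) q < size q)%N.
Proof.
move=> red_q q_gt0; rewrite ltnNge; apply/negP => le_q.
have [x0 _] : exists x0 : letter, True by case: (q) q_gt0 => [//|x0]; exists x0.
pose m := (size q)./2.
have nthV i : (i < lcp (winv q) q)%N -> nth x0 q i = linv (nth x0 q (size q - i.+1)).
  move=> lt_i; rewrite -(lcp_nth x0 lt_i) /winv.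
  have lt_iq: (i < size q)%N by rewrite (leq_trans lt_i) // lcpC lcp_leq.
  rewrite nth_rev size_map // (nth_map x0) //; lia.
have szq := odd_double_half (size q).
case: (boolP (odd (size q))) => odd_q; rewrite ?odd_q ?(negbTE odd_q) /= in szq.
  have := nthV m; rewrite -szq -/m -addnn.
  have -> : (1 + (m + m) - m.+1 = m)%N by lia.
  have -> : (m < lcp (winv q) q)%N by lia.
  by case: (nth x0 q m) => i b /(_ isT) [] /esym; case: b.
have m_gt0: (0 < m)%N by lia.
have := nthV m.-1.
have -> : (size q - m.-1.+1 = m)%N by lia.
have -> : (m.-1 < lcp (winv q) q)%N by lia.
move=> /(_ isT) eq_m.
have := red_q; rewrite /reduced => /(sortedP x0) /(_ m.-1).
rewrite prednK // eq_m linvK eqxx => /implyP; rewrite implybF; lia.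
Qed.

(** * Nielsen reduction *)

Definition norm (g : F2) : nat := size (word g).
(** The Gromov product at 1 in the Cayley tree of [F2]; the cancellation estimates rest on its
    ultrametric inequality. *)
Definition cpl (g h : F2) : nat := lcp (word g) (word h).

Arguments norm g%_g.
Arguments cpl (g h)%_g.

Lemma normV (g : F2) : norm g^-1 = norm g.
Proof.
rewrite /norm /= reduce_id ?reduced_winv ?wordP //.
by rewrite /winv size_rev size_map.
Qed.

Lemma word_inv (g : F2) : word g^-1 = winv (word g).
Proof. by rewrite /= reduce_id ?reduced_winv ?wordP. Qed.

Lemma norm_mulVg (g h : F2) : (norm (g^-1 * h) + 2 * cpl g h = norm g + norm h)%N.
Proof.
rewrite -(size_reduce_winv (wordP g) (wordP h)) /norm -word_inv.
by [].
Qed.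

Lemma norm_mulg (g h : F2) : (norm (g * h) + 2 * cpl g^-1 h = norm g + norm h)%N.
Proof. by rewrite -{1}[g]invgK norm_mulVg normV. Qed.

Lemma norm_eq0 (g : F2) : norm g = 0%N -> g = 1.
Proof. by move/size0nil => g0; apply: val_inj. Qed.

Lemma cplC (g h : F2) : cpl g h = cpl h g. Proof. exact: lcpC. Qed.

Lemma cplxx (g : F2) : cpl g g = norm g. Proof. exact: lcp_refl. Qed.

Lemma cpl_ultra (h g k : F2) : (minn (cpl g h) (cpl h k) <= cpl g k)%N.
Proof. exact: lcp_ultra. Qed.

Lemma cplV_lt (g : F2) : (0 < norm g)%N -> (2 * cpl g^-1 g < norm g)%N.
Proof. by rewrite /cpl word_inv; apply: lcp_winv; exact: wordP. Qed.

Lemma cpl_prefix k (g : F2) : (k <= norm g)%N -> exists2 p, norm p = k & cpl p g = k.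
Proof.
move=> le_kg; have red_p : reduced (take k (word g)).
  by move: (wordP g); rewrite -{1}[word g](cat_take_drop k); case/cat_sorted2.
exists (MkF2 red_p); first by rewrite /norm /= size_takel.
exact: lcp_take.
Qed.

(* No letter is completely cancelled by its neighbours in a reduced word in
   u and v. *)
Definition nielsen_reduced (u v : F2) : Prop :=
  forall a b d : letter, b != linv a -> d != linv b ->
  (cpl (ev_letter u v a)^-1 (ev_letter u v b)
   + cpl (ev_letter u v b)^-1 (ev_letter u v d) < norm (ev_letter u v b))%N.

Lemma linv_neq (a : letter) : a != linv a.
Proof. by case: a => i []; apply/eqP => -[]. Qed.

Definition junction (u v : F2) (a : letter) (w : seq letter) : nat :=
  if w is b :: _ then cpl (ev_letter u v a)^-1 (ev_letter u v b) else 0.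

(** The letter after [a] is never wholly absorbed, so [a] loses to the rest of the word only what it
    loses to that letter, and each further letter adds at least one to the length. *)
Lemma nielsen_reduced_norm (u v : F2) a w : nielsen_reduced u v -> reduced (a :: w) ->
  let P := ev_word u v (a :: w) in
  (norm (ev_letter u v a) <= cpl (ev_letter u v a) P + junction u v a w)%N /\
  (norm (ev_letter u v a) + size w <= norm P + junction u v a w)%N.
Proof.
move=> redN; elim: w a => [|b w IHw] a /=.
  by rewrite mulg1 cplxx !addn0.
case/andP => ne_ba red_bw; have := IHw b red_bw.
rewrite [ev_word _ _ (b :: w)]/=; set P := (_ * ev_word u v w) => /= -[le1 le2].
set c := cpl (ev_letter u v a)^-1 (ev_letter u v b).
have lt_c : (c + junction u v b w < norm (ev_letter u v b))%N.
  case: w red_bw {IHw} @P le1 le2 => [|d w] /=.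
    (* The last letter [b] has no successor; [b] itself serves, being different from its inverse. *)
    move=> _ _ _; have := redN a b b ne_ba (linv_neq b); lia.
  by case/andP => ne_db _ _ _; exact: redN.
(* [P] shares more than [c] letters with the image of [b], so by the ultrametric inequality both
   cancel equally against that of [a]. *)
have ceq : cpl (ev_letter u v a)^-1 P = c.
  have := cpl_ultra (ev_letter u v b) (ev_letter u v a)^-1 P.
  have := cpl_ultra P (ev_letter u v a)^-1 (ev_letter u v b).
  rewrite (cplC P) -/c; lia.
have := norm_mulg (ev_letter u v a) P.
have := norm_mulVg (ev_letter u v a) (ev_letter u v a * P).
rewrite mulKg ceq.
move: (cpl _ (_ * P)) (norm (_ * P)) => x y; move: le1 le2 lt_c.
move: (cpl _ P) (norm P) (junction _ _ _ _) (norm _) (norm _) c {ceq} => *.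
split; lia.
Qed.

Lemma nielsen_reduced_letter (u v w : F2) : nielsen_reduced u v ->
  norm (ev u v w) = 1%N -> exists a, ev u v w = ev_letter u v a.
Proof.
move=> redN; rewrite /ev; case: w => w red_w /=; case: w red_w => [//|a w] red_w.
have [_] := nielsen_reduced_norm redN red_w.
case: w red_w => [|b w] red_w /=; first by exists a; rewrite mulg1.
by case/andP: red_w => ne_ba _; have := redN a a b (linv_neq a) ne_ba; lia.
Qed.

Definition generates (u v : F2) : Prop := forall w, exists w', ev u v w' = w.

Lemma generates_trans (u v u' v' : F2) : generates u v ->
  (exists w, ev u' v' w = u) -> (exists w, ev u' v' w = v) -> generates u' v'.
Proof.
move=> gen_uv [wu evu] [wv evv] w; have [w' <-] := gen_uv w.
by exists (ev wu wv w'); rewrite (gmulf_ev (ev u' v')) /= evu evv.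
Qed.

Lemma expo_ev i (u v w : F2) :
  (expo i (ev u v w) = expo i u * expo ord0 w + expo i v * expo ord_max w)%R.
Proof.
rewrite (additive_expo (h := fun w => expo i (ev u v w))); last first.
  by move=> w1 w2; rewrite gmulfM expoM.
by rewrite !big_ord_recl big_ord0 addr0 (_ : lift _ _ = ord_max) ?evX ?evY //;
  apply: val_inj.
Qed.

(** In the abelianization, multiples of a single vector cannot give both basis vectors of Z^2. *)
Lemma generates_neq1 (u v : F2) : generates u v -> u != 1.
Proof.
move=> gen_uv; apply/eqP => u1; rewrite u1 in gen_uv.
have expo1 i : expo i 1 = 0%R by rewrite /expo /expo_word big_nil.
have [wx ex] := gen_uv X; have [wy ey] := gen_uv Y.
have := congr1 (expo ord0) ex; have := congr1 (expo ord_max) ex.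
have := congr1 (expo ord0) ey; have := congr1 (expo ord_max) ey.
rewrite !expo_ev !expo1 !mul0r !add0r !expo_gen /=.
set p := expo ord_max wx; set q := expo ord_max wy.
set a := expo ord0 v; set b := expo ord_max v.
by move=> e1 e2 e3 e4; nia.
Qed.

Lemma generates_letter (u v : F2) a b : a.1 != b.1 ->
  generates u v -> generates (ev_letter u v a) (ev_letter u v b).
Proof.
case: a b => [i a] [j b] /=.
case: (ord2P i) => ->; case: (ord2P j) => -> //= _ /generates_trans;
  rewrite /ev_letter /=; apply.
- exists (if a then X^-1 else X).
  by case: a; rewrite ?evV evX ?invgK.
- exists (if b then Y^-1 else Y).
  by case: b; rewrite ?evV evY ?invgK.
- exists (if b then Y^-1 else Y).
  by case: b; rewrite ?evV evY ?invgK.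
- exists (if a then X^-1 else X).
  by case: a; rewrite ?evV evX ?invgK.
Qed.

Lemma generates_mulr (p q : F2) : generates p q -> generates (p * q) q.
Proof.
move/generates_trans; apply; last by exists Y; rewrite evY.
by exists (X * Y^-1); rewrite evM evV evX evY mulgK.
Qed.

Lemma generates_mull (p q : F2) : generates p q -> generates (q * p) q.
Proof.
move/generates_trans; apply; last by exists Y; rewrite evY.
by exists (Y^-1 * X); rewrite evM evV evX evY mulKg.
Qed.

Lemma generates_swap (p q : F2) : generates p q -> generates q p.
Proof.
by move/generates_trans; apply; [exists Y; rewrite evY | exists X; rewrite evX].
Qed.

Lemma generates_conj (g p q : F2) : generates p q -> generates (p ^ g) (q ^ g).
Proof.
move=> gen_pq w; have [w' e] := gen_pq (w ^ g^-1); exists w'.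
by rewrite -[RHS](conjgKV g) -e -/(conj_by g (ev p q w')) gmulf_ev.
Qed.

(* When [q] is cancelled exactly half by [p] on the right and half by [p] on
   the left, [q = g h^-1] and [p = h m g^-1] with [|g| = |h|], so [q p]
   conjugates to [m]. *)
Lemma half_cancel (p q : F2) : (0 < norm q)%N ->
  norm q = (2 * cpl p^-1 q)%N -> norm q = (2 * cpl q^-1 p)%N ->
  (norm q <= norm p)%N ->
  exists g, (norm ((q * p) ^ g) < norm p)%N /\ (norm (q ^ g) <= norm q)%N.
Proof.
move=> q_gt0; have [h] : exists h, h = cpl p^-1 q by eexists.
move=> hE; rewrite -hE => e1 e2 le_qp.
have [|g normg cplg] := @cpl_prefix h q; first lia.
exists g; have [q1 q1E] : exists q1 : F2, q1 = g^-1 * q by eexists.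
have normq1 : norm q1 = h by have := norm_mulVg g q; rewrite cplg normg -q1E; lia.
split; last first.
  rewrite conjgE mulgA -q1E; suff : (norm (q1 * g) <= norm q)%N by [].
  by have := norm_mulg q1 g; lia.
rewrite conjgE !mulgA -q1E; have [r rE] : exists r : F2, r = q1 * p by eexists.
rewrite -rE; suff : (norm (r * g) < norm p)%N by [].
have E1 : cpl q^-1 q1^-1 = h.
  have := norm_mulVg q^-1 q1^-1; rewrite !normV invgK q1E invgM invgK mulVKg.
  by rewrite -q1E; lia.
have E2 : (norm r + h <= norm p)%N.
  have := norm_mulg q1 p; have := cpl_ultra q^-1 q1^-1 p.
  rewrite (cplC q1^-1) E1 -rE; lia.
have E3 : (0 < cpl p^-1 r^-1)%N.
  have := norm_mulVg p^-1 r^-1; rewrite invgK !normV rE invgM mulVKg normV -rE.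
  lia.
have E4 : (h <= cpl p^-1 g)%N.
  by have := cpl_ultra q p^-1 g; rewrite (cplC q g) cplg -hE; lia.
have := cpl_ultra p^-1 r^-1 g; have := norm_mulg r g; rewrite (cplC _ p^-1); lia.
Qed.

(** * Induction along Nielsen moves *)

Section NielsenInduction.
Variable Pr : F2 -> F2 -> Prop.
Hypothesis Pr_gen : Pr X Y.
Hypothesis Pr_conj : forall g u v : F2, Pr u v -> Pr (u ^ g) (v ^ g).
Hypothesis Pr_swap : forall u v : F2, Pr u v -> Pr v u.
Hypothesis Pr_inv : forall u v : F2, Pr u v -> Pr u^-1 v.
Hypothesis Pr_mul : forall u v : F2, Pr u v -> Pr (u * v) v.

(** Nielsen moves and conjugations are invertible, so [Pr] also descends along them. *)
Let Pr_invE (u v : F2) : Pr u^-1 v -> Pr u v.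
Proof. by move/Pr_inv; rewrite invgK. Qed.

Let Pr_mulE (u v : F2) : Pr (u * v) v -> Pr u v.
Proof.
move/Pr_swap/Pr_inv/Pr_swap/Pr_mul; rewrite mulgK.
by move/Pr_swap/Pr_invE/Pr_swap.
Qed.

Let Pr_mullE (u v : F2) : Pr (v * u) v -> Pr u v.
Proof. by move/Pr_inv; rewrite invgM => /Pr_mul; rewrite mulgVK => /Pr_invE. Qed.

Let Pr_conjE (g u v : F2) : Pr (u ^ g) (v ^ g) -> Pr u v.
Proof. by move/(Pr_conj g^-1); rewrite !conjgK. Qed.

Let Pr_letter (u v : F2) a b : a.1 != b.1 ->
  Pr (ev_letter u v a) (ev_letter u v b) -> Pr u v.
Proof.
case: a b => [i a] [j b] /=.
case: (ord2P i) => ->; case: (ord2P j) => -> //= _; rewrite /ev_letter /=.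
- case: a; case: b => //.
  + by move/Pr_invE/Pr_swap/Pr_invE/Pr_swap.
  + by move/Pr_invE.
  + by move/Pr_swap/Pr_invE/Pr_swap.
- case: a; case: b => //; last exact: Pr_swap.
  + by move/Pr_invE/Pr_swap/Pr_invE.
  + by move/Pr_invE/Pr_swap.
  + by move/Pr_swap/Pr_invE.
Qed.

(** Induction on the total length. For a reduced pair, [X] and [Y] have length one and are therefore
    letters in [u] and [v]; any other pair is shortened by a Nielsen move, possibly followed by a
    conjugation. *)
Theorem nielsen_ind (u v : F2) : generates u v -> Pr u v.
Proof.
have [n] := ubnP (norm u + norm v); elim: n u v => [//|n IHn] u v lt_n gen_uv.
have [redN|] := pselect (nielsen_reduced u v).
  have [wx ex] := gen_uv X; have [wy ey] := gen_uv Y.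
  have [|a ea] := nielsen_reduced_letter (w := wx) redN; first by rewrite ex.
  have [|b eb] := nielsen_reduced_letter (w := wy) redN; first by rewrite ey.
  rewrite ex in ea; rewrite ey in eb.
  apply: (@Pr_letter _ _ a b); last by rewrite -ea -eb.
  (* If both letters came from the same generator, [X] would be [Y] or its inverse, against the
     exponents. *)
  apply/eqP => eq_ab; have [eq_XY|eq_XY] : X = Y \/ X = Y^-1.
    case: a b ea eb eq_ab => [i a] [j b] /= -> -> ->; rewrite /ev_letter /=.
    by case: a; case: b; rewrite ?invgK; auto.
  - by move: (congr1 (expo ord0) eq_XY); rewrite !expo_gen.
  - move: (congr1 (fun w => expo ord0 (w * Y)) eq_XY).
    by rewrite mulVg expoM !expo_gen /expo /expo_word big_nil.
have normL a : (norm (ev_letter u v a) = if a.1 == ord0 then norm u else norm v).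
  by case: a => i []; rewrite /ev_letter /= ?normV; case: ifP.
have sumL a b : a.1 != b.1 ->
    (norm (ev_letter u v a) + norm (ev_letter u v b) = norm u + norm v)%N.
  rewrite !normL; case: a b => [i a] [j b] /=.
  by case: (ord2P i) => ->; case: (ord2P j) => -> //= _; rewrite addnC.
have posL a : (0 < norm (ev_letter u v a))%N.
  rewrite normL lt0n; case: ifP => _; apply/eqP => /norm_eq0/eqP.
    exact/negP/(generates_neq1 gen_uv).
  exact/negP/(generates_neq1 (generates_swap gen_uv)).
have stepL a b p q : a.1 != b.1 -> (norm p + norm q < norm u + norm v)%N ->
    (generates (ev_letter u v a) (ev_letter u v b) -> generates p q) ->
    (Pr p q -> Pr (ev_letter u v a) (ev_letter u v b)) -> Pr u v.
  move=> ne_ab lt_pq gen_pq toL; apply: (Pr_letter ne_ab); apply: toL.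
  by apply: IHn; [lia | exact/gen_pq/generates_letter].
(* If [Pr u v] fails, the induction hypothesis forbids every move that shortens the pair; hence
   cancellation takes at most half of either factor. *)
have [//|notPr] := pselect (Pr u v).
have le_mul a b : a.1 != b.1 ->
    (norm (ev_letter u v a) <= norm (ev_letter u v a * ev_letter u v b))%N.
  move=> ne_ab; rewrite leqNgt; apply/negP => lt_ab; apply: notPr.
  apply: (stepL a b _ _ ne_ab _ (@generates_mulr _ _) (@Pr_mulE _ _)).
  by rewrite -(sumL _ _ ne_ab) ltn_add2r.
have ge_mul a b : a.1 != b.1 ->
    (norm (ev_letter u v a) <= norm (ev_letter u v b * ev_letter u v a))%N.
  move=> ne_ab; rewrite leqNgt; apply/negP => lt_ab; apply: notPr.
  apply: (stepL a b _ _ ne_ab _ (@generates_mull _ _) (@Pr_mullE _ _)).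
  by rewrite -(sumL _ _ ne_ab) ltn_add2r.
have le_half a b : a.1 != b.1 ->
    (2 * cpl (ev_letter u v a)^-1 (ev_letter u v b) <= norm (ev_letter u v a))%N
    /\ (2 * cpl (ev_letter u v a)^-1 (ev_letter u v b)
        <= norm (ev_letter u v b))%N.
  move=> ne_ab.
  have e : (norm (ev_letter u v a * ev_letter u v b)
      + 2 * cpl (ev_letter u v a)^-1 (ev_letter u v b)
      = norm (ev_letter u v a) + norm (ev_letter u v b))%N by exact: norm_mulg.
  have := le_mul _ _ ne_ab; rewrite eq_sym in ne_ab; have := ge_mul _ _ ne_ab.
  by split; lia.
have same a b : b != linv a -> a.1 == b.1 -> a = b.
  case: a b => [i a] [j b] /= ne /eqP eq_ij; rewrite eq_ij in ne *.
  by congr (_, _); move: ne; rewrite /linv /=; case: a; case: b; rewrite ?eqxx.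
have lt_same b : (2 * cpl (ev_letter u v b)^-1 (ev_letter u v b)
    < norm (ev_letter u v b))%N by exact/cplV_lt/posL.
have ultra a b : (minn (cpl (ev_letter u v b)^-1 (ev_letter u v a)^-1)
      (cpl (ev_letter u v a)^-1 (ev_letter u v b))
    <= cpl (ev_letter u v b)^-1 (ev_letter u v b))%N by exact: cpl_ultra.
(* A letter [b] wholly cancelled by its neighbours. A neighbour on the same generator equals [b] and
   cancels less than half of it; so both neighbours lie on the other generator and cancel exactly
   half each. *)
case=> a b d ne_ba ne_db; rewrite ltnNge; apply/negP => le_b.
have [eq_ab|ne_ab] := boolP (a.1 == b.1).
  have := same _ _ ne_ba eq_ab => {ne_ba eq_ab}eq_ab; subst a.
  have lt_bb := lt_same b.
  have [eq_bd|ne_bd] := boolP (b.1 == d.1).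
    by move: le_b; rewrite -(same _ _ ne_db eq_bd); lia.
  have [_] := le_half _ _ ne_bd; have [] := le_half _ _ ne_bd; lia.
have [eq_bd|ne_bd] := boolP (b.1 == d.1).
  move: le_b; rewrite -(same _ _ ne_db eq_bd).
  have lt_bb := lt_same b; have [_] := le_half _ _ ne_ab; lia.
have [le_a1 le_b1] := le_half _ _ ne_ab; have [le_b2 le_d2] := le_half _ _ ne_bd.
have [eq_da|ne_da] := boolP (d == linv a).
  move: le_b le_b2; rewrite (eqP eq_da) ev_linv => le_b le_b2.
  have lt_bb := lt_same b.
  have := ultra a b; lia.
have eq_ad : a = d.
  apply: same ne_da _; move: ne_ab ne_bd.
  by case: (ord2P a.1) => ->; case: (ord2P b.1) => ->; case: (ord2P d.1) => ->.
subst d; apply: notPr.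
have e1 : norm (ev_letter u v b) = (2 * cpl (ev_letter u v a)^-1 (ev_letter u v b))%N.
  lia.
have e2 : norm (ev_letter u v b) = (2 * cpl (ev_letter u v b)^-1 (ev_letter u v a))%N.
  lia.
have le_ba : (norm (ev_letter u v b) <= norm (ev_letter u v a))%N by lia.
have [g [lt_g le_g]] := half_cancel (posL b) e1 e2 le_ba.
apply: (stepL a b _ _ ne_ab _ _ _); last first.
- by move=> /Pr_conjE; exact: Pr_mullE.
- by move=> gen_ab; apply/generates_conj/generates_mull.
- by rewrite -(sumL _ _ ne_ab) -addSn; exact: leq_add lt_g le_g.
Qed.

End NielsenInduction.

(** * Squared Dehn twists and a normal form for generating pairs *)

(* The squares of the transvections along the two generators.  They generate
   the Sanov subgroup of SL2(Z), of index 24 in GL2(Z). *)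
Definition twist_x (l : letter) : F2 :=
  if l.1 == ord0 then X else if l.2 then X * Y^-1 * Y^-1 else X * Y * Y.
Definition twist_y (l : letter) : F2 :=
  if l.1 == ord0 then if l.2 then X * X * Y else X^-1 * X^-1 * Y else Y.
Definition twist1 (l : letter) : F2 -> F2 := ev (twist_x l) (twist_y l).

HB.instance Definition _ l := Multiplicative.on (twist1 l).

Definition twist (s : seq letter) (w : F2) : F2 := foldr twist1 w s.

Lemma twistM s : {morph twist s : u v / u * v}.
Proof. by move=> u v; elim: s => [//|l s IHs] /=; rewrite IHs gmulfM. Qed.

HB.instance Definition _ s := isMultiplicative.Build F2 F2 (twist s) (twistM s).

Lemma twist_cat s1 s2 w : twist (s1 ++ s2) w = twist s1 (twist s2 w).
Proof. exact: foldr_cat. Qed.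

(** The six pairs reduce to the six bases of (Z/2)^2; each occurs with all four choices of
    inversions. *)
Definition coset_reps : seq (F2 * F2) :=
  [seq (if e.1 then b.1^-1 else b.1, if e.2 then b.2^-1 else b.2)
     | b <- [:: (X, Y); (Y, X); (X * Y, Y); (Y, X * Y); (X, X * Y); (X * Y, X)],
       e <- [:: (false, false); (false, true); (true, false); (true, true)]].

Definition pair_moves (t : F2 * F2) : seq (F2 * F2) :=
  [:: (t.2, t.1); (t.1^-1, t.2); (t.1 * t.2, t.2)].

(* The twists and conjugators needed to bring a Nielsen move of a coset
   representative back to a coset representative. *)
Definition correction : seq (seq letter * F2) :=
  let x := (ord0, false) in let x' := (ord0, true) in
  let y := (ord_max, false) in let y' := (ord_max, true) in
  [seq (p.1, mkF2 p.2) | p <- [:: ([::], [::]);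
    ([::], [:: x]); ([::], [:: x']); ([::], [:: y]); ([::], [:: y']);
    ([::], [:: x; y]); ([::], [:: y'; x']);
    ([:: x], [::]); ([:: x], [:: x']); ([:: x'], [::]); ([:: x'], [:: x]);
    ([:: y], [::]); ([:: y], [:: y']); ([:: y'], [::]); ([:: y'], [:: y]);
    ([:: y; x], [:: y']); ([:: y; x], [:: y'; y'; x']);
    ([:: x'; y'], [:: x]); ([:: x'; y'], [:: x; x; y])]].

Lemma pair_moves_coset_reps :
  all (fun t => all (fun n => has (fun c => has (fun t' =>
      (n.1 == twist c.1 t'.1 ^ c.2) && (n.2 == twist c.1 t'.2 ^ c.2))
    coset_reps) correction) (pair_moves t)) coset_reps.
Proof. by vm_compute. Qed.

Definition normal_form (u v : F2) : Prop :=
  exists s g t, [/\ t \in coset_reps, u = twist s t.1 ^ g & v = twist s t.2 ^ g].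

(** Nielsen moves commute with applying [twist s] and conjugating, so it suffices to correct the
    move of the representative, which the finite table does. *)
Lemma normal_form_move s g t n : t \in coset_reps -> n \in pair_moves t ->
  normal_form (twist s n.1 ^ g) (twist s n.2 ^ g).
Proof.
move=> tT nt; have /allP /(_ t tT) /allP /(_ n nt) := pair_moves_coset_reps.
move=> /hasP[c _ /hasP[t' t'T /andP[/eqP-> /eqP->]]].
exists (s ++ c.1), (twist s c.2 * g), t'.
by split=> //; rewrite twist_cat mulfJ conjgM.
Qed.

Lemma generates_normal_form u v : generates u v -> normal_form u v.
Proof.
apply: nielsen_ind => {u v}.
- have XYT : (X, Y) \in coset_reps.
    by apply/allpairsP; exists ((X, Y), (false, false)); rewrite !inE !eqxx.
  by exists [::], 1, (X, Y); split; rewrite ?conjg1.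
- move=> h u v [s [g [t [tT -> ->]]]]; exists s, (g * h), t.
  by split=> //; rewrite conjgM.
- move=> u v [s [g [t [tT -> ->]]]].
  by apply: (normal_form_move s g (n := (t.2, t.1)) tT); rewrite inE eqxx.
- move=> u v [s [g [t [tT -> ->]]]]; rewrite -conjVg -mulfV.
  by apply: (normal_form_move s g (n := (t.1^-1, t.2)) tT); rewrite !inE eqxx orbT.
- move=> u v [s [g [t [tT -> ->]]]]; rewrite -conjMg -gmulfM.
  by apply: (normal_form_move s g (n := (t.1 * t.2, t.2)) tT);
    rewrite !inE eqxx !orbT.
Qed.

(** * Congruences for the Sanov subgroup *)

Section Sanov.
Local Open Scope ring_scope.

Definition sanov (u v : F2) : Prop :=
  [/\ (4 %| (expo ord0 u - 1)%R)%Z, (2 %| expo ord_max u)%Z,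
      (2 %| expo ord0 v)%Z & (4 %| (expo ord_max v - 1)%R)%Z].

Lemma expo_twist1 i l w : expo i (twist1 l w) =
  expo i w + if (i == ord0) && (l.1 == ord0) then - 2 * (-1) ^+ l.2 * expo ord_max w
    else if (i == ord_max) && (l.1 == ord_max) then 2 * (-1) ^+ l.2 * expo ord0 w
    else 0.
Proof.
rewrite expo_ev; case: l => j b; rewrite /twist_x /twist_y.
by case: (ord2P i) => ->; case: (ord2P j) => ->; case: b;
  rewrite ?expoM /expo /expo_word /= ?big_cons ?big_nil /=; ring.
Qed.

Lemma sanov_twist1 l u v : sanov (twist1 l u) (twist1 l v) -> sanov u v.
Proof.
rewrite /sanov !expo_twist1; case: l => j b /=.
by case: (ord2P j) => -> /=; case: b => /= -[*]; split; lia.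
Qed.

Lemma sanov_twist s u v : sanov (twist s u) (twist s v) -> sanov u v.
Proof. by elim: s => [//|l s IHs] /= /sanov_twist1. Qed.

Lemma expo_conj i w g : expo i (w ^ g)%g = expo i w.
Proof.
rewrite conjgE !expoM addrCA -expoM mulVg.
by rewrite [expo i 1%g]/expo /expo_word big_nil addr0.
Qed.

Lemma expoV i w : expo i w^-1%g = - expo i w.
Proof.
apply: (addrI (expo i w)); rewrite -expoM mulgV subrr.
by rewrite /expo /expo_word big_nil.
Qed.

(** The parities single out the basis [(X, Y)] modulo 2, and the diagonal congruences modulo 4 fix
    both signs. *)
Lemma sanov_coset_reps t : t \in coset_reps -> sanov t.1 t.2 -> t = (X, Y).
Proof.
case/allpairsP => -[b e] [b_in e_in -> {t}].
rewrite /sanov.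
have expoE :
    (forall i, expo i (if e.1 then b.1^-1 else b.1)%g = (-1) ^+ e.1 * expo i b.1)
    /\ (forall i, expo i (if e.2 then b.2^-1 else b.2)%g = (-1) ^+ e.2 * expo i b.2).
  by split=> i; case: ifP => _; rewrite ?expoV ?mulN1r ?mul1r.
rewrite /= !expoE.1 !expoE.2 {expoE}.
move: b_in e_in; rewrite !inE /=.
by do 5?[case/orP]; move=> /eqP->; do 3?[case/orP]; move=> /eqP-> //=;
   rewrite ?expoM ?expo_gen // => -[].
Qed.

End Sanov.

(** * Regular wreath products *)

Definition wreath (G P : finGroupType) : Type := ({ffun P -> G} * P)%type.
HB.instance Definition _ (G P : finGroupType) := Finite.on (wreath G P).

Section Wreath.
Variables G P : finGroupType.
Implicit Types u v : wreath G P.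

Definition wr (f : {ffun P -> G}) (s : P) : wreath G P := (f, s).

(** The product of monomial matrices, where [(f, s)] has the entry [f i] in row [i] and column
    [i * s]. *)
Definition wr_mul u v := wr [ffun i => u.1 i * v.1 (i * u.2)] (u.2 * v.2).
Definition wr_one := wr [ffun=> 1] 1.
Definition wr_inv u := wr [ffun i => (u.1 (i * u.2^-1))^-1] u.2^-1.

Fact wr_mulA : associative wr_mul.
Proof.
by move=> u v w; congr (_, _); rewrite ?mulgA //;
  apply/ffunP => i; rewrite !ffunE /= !mulgA.
Qed.

Fact wr_mul1g : left_id wr_one wr_mul.
Proof.
case=> f s; congr (_, _); last exact: mul1g.
by apply/ffunP => i; rewrite !ffunE /= mul1g mulg1.
Qed.

Fact wr_mulVg : left_inverse wr_one wr_inv wr_mul.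
Proof.
case=> f s; congr (_, _); last exact: mulVg.
by apply/ffunP => i; rewrite !ffunE /= mulVg.
Qed.

HB.instance Definition _ :=
  Finite_isGroup.Build (wreath G P) wr_mulA wr_mul1g wr_mulVg.

Lemma wrM1 u v i : (u * v).1 i = u.1 i * v.1 (i * u.2).
Proof. exact: ffunE. Qed.
Lemma wrM2 u v : (u * v).2 = u.2 * v.2. Proof. by []. Qed.
Lemma wrV1 u i : u^-1.1 i = (u.1 (i * u.2^-1))^-1. Proof. exact: ffunE. Qed.
Lemma wrV2 u : u^-1.2 = u.2^-1. Proof. by []. Qed.
Lemma wr11 i : (1 : wreath G P).1 i = 1. Proof. exact: ffunE. Qed.

Lemma wr_eq u v : u.2 = v.2 -> (forall i, u.1 i = v.1 i) -> u = v.
Proof. by case: u v => [f s] [g t] /= -> /ffunP ->. Qed.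

Lemma wrJ2 u v : (u ^ v).2 = u.2 ^ v.2. Proof. by []. Qed.

Lemma wrJ1 u v i : u.2 = 1 ->
  (u ^ v).1 i = u.1 (i * v.2^-1) ^ v.1 (i * v.2^-1).
Proof. by move=> u1; rewrite conjgE !wrM1 wrV1 wrV2 u1 mulg1 -conjgE. Qed.

Lemma wrJfun u (k : {ffun P -> G}) i :
  (u ^ wr k 1).1 i = (k i)^-1 * (u.1 i * k (i * u.2)).
Proof. by rewrite conjgE !wrM1 wrV1 wrV2 /= !invg1 !mulg1. Qed.

End Wreath.

(** * Monodromy of a four-punctured sphere *)

Definition V4 : Type := ('I_2 * 'I_2)%type.
HB.instance Definition _ := FinGroup.on V4.

Lemma mulI2 (i j : 'I_2) : i * j = if i == j then ord0 else ord_max.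
Proof. by apply: val_inj; case: (ord2P i) => ->; case: (ord2P j) => ->. Qed.

Lemma mulV4 (i j : V4) : i * j = (i.1 * j.1, i.2 * j.2).
Proof. by []. Qed.

Lemma mul1V4 : 1 = (ord0, ord0) :> V4. Proof. by []. Qed.

Lemma invV4 (i : V4) : i^-1 = i.
Proof.
apply: (mulgI i); rewrite mulgV; case: i => i j; rewrite mulV4 /= !mulI2.
by rewrite !eqxx.
Qed.

Section Monodromy.
Variable G : finGroupType.

Definition quad (p00 p10 p01 p11 : G) : {ffun V4 -> G} :=
  [ffun i => if i.1 == ord0 then if i.2 == ord0 then p00 else p01
             else if i.2 == ord0 then p10 else p11].

(* A triple [(a, c, b)] is a homomorphism to [G] from the free fundamental
   group of the sphere minus the four branch points of the elliptic curve,
   given by the loops around three of them.  That group and [F2] are subgroups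
   of [Z/2 * Z/2 * Z/2], of index 4 and 2; [mono] is the restriction to [F2]
   of the induced homomorphism to [G wr V4]. *)
Definition triple : Type := (G * G * G)%type.

Definition mono (h : triple) : F2 -> wreath G V4 :=
  let: (a, c, b) := h in
  ev (wr (quad a c (a * c)^-1 1) (ord_max, ord0))
     (wr (quad c 1 b (c * b)^-1) (ord0, ord_max)).

Lemma monoM h : {morph mono h : u v / u * v}.
Proof. by case: h => [[a c] b] u v; exact: evM. Qed.

HB.instance Definition _ h :=
  isMultiplicative.Build F2 (wreath G V4) (mono h) (monoM h).

(** A full turn of two neighbouring branch points about each other: it conjugates both loops by
    their product, or by its inverse, and fixes that product. *)
Definition braid1 (l : letter) (h : triple) : triple :=
  let: (a, c, b) := h in
  if l.1 == ord0 then
    let d := if l.2 then (a * c)^-1 else a * c in (a ^ d, c ^ d, b)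
  else
    let d := if l.2 then (c * b)^-1 else c * b in (a, c ^ d, b ^ d).

(** A left fold, since precomposing with [twist s] meets the first letter of [s] first. *)
Definition braid (s : seq letter) (h : triple) : triple := 
  foldl (fun h l => braid1 l h) h s.

Lemma mono_twist1 l h : exists k : {ffun V4 -> G}, k 1 = 1 /\
  forall w, mono h (twist1 l w) = mono (braid1 l h) w ^ wr k 1.
Proof.
case: h l => [[a c] b] l.
have ext h (k : {ffun V4 -> G}) : k 1 = 1 ->
    mono (a, c, b) (twist_x l) = mono h X ^ wr k 1 ->
    mono (a, c, b) (twist_y l) = mono h Y ^ wr k 1 ->
    exists k : {ffun V4 -> G}, k 1 = 1 /\
      forall w, mono (a, c, b) (twist1 l w) = mono h w ^ wr k 1.
  move=> k1 eX eY; exists k; split=> // w.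
  rewrite -/(conj_by (wr k 1) (mono h w)).
  by apply: (hom_ext (f := mono (a, c, b) \o twist1 l)
    (g := conj_by (wr k 1) \o mono h)); rewrite /= /twist1 ?evX ?evY.
have wrE := (wrM1, wrV1, wrM2, wrV2, invV4, mulV4, mulI2, mul1V4).
case: l ext => i e ext.
pose ac := if e then (a * c)^-1 else a * c.
pose cb := if e then (c * b)^-1 else c * b.
(* Starting from 1 on the base sheet, comparing both sides on [X] and [Y] determines the conjugator
   on the other three sheets. *)
apply: (ext (braid1 (i, e) (a, c, b))
  (if i == ord0 then quad 1 (ac^-1 * ac ^ a) ac^-1 ac^-1
   else quad 1 cb^-1 (cb^-1 * cb ^ c) cb^-1)); rewrite {ext}/ac {}/cb.
  by case: ifP; rewrite ffunE.
all: case: (ord2P i) => -> /=; case: e;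
  rewrite /twist_x /twist_y /mono /= ?evM ?evV ?evX ?evY.
all: apply: wr_eq => [|[j1 j2]]; first by rewrite wrJ2 conjg1 /= ?wrE /= ?wrE.
all: rewrite wrJfun.
all: case: (ord2P j1) => ->; case: (ord2P j2) => ->.
all: rewrite ?wrE /= ?wrE /= ?wrE /= /quad ?ffunE /= ?conjgE ?gnorm.
all: by rewrite ?gnorm.
Qed.

Lemma mono_twist s h : exists k : {ffun V4 -> G}, k 1 = 1 /\
  forall w, mono h (twist s w) = mono (braid s h) w ^ wr k 1.
Proof.
elim: s h => [|l s IHs] h /=.
  exists [ffun=> 1]; split=> [|w]; first by rewrite ffunE.
  by rewrite (_ : wr _ _ = 1) ?conjg1.
have [k1 [k11 e1]] := mono_twist1 l h; have [k2 [k21 e2]] := IHs (braid1 l h).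
exists [ffun i => k2 i * k1 i]; split=> [|w]; first by rewrite ffunE k11 k21 mulg1.
rewrite e1 e2 -conjgM; congr (_ ^ _); apply: wr_eq => [|i]; first exact: mulg1.
by rewrite wrM1 /= mulg1 ffunE.
Qed.

End Monodromy.

Definition puncture : F2 := Y * X^-1 * Y^-1 * X.

Section LocalMonodromy.
Variables (G : finGroupType) (a c b : G).

Let wrE := (wrM1, wrV1, wrM2, wrV2, invV4, mulV4, mulI2, mul1V4).

(** The commutator [puncture] is a loop around the puncture of the torus. Its four lifts go around
    the ramification points of a double cover, whence squares of the loops around the branch points,
    the fourth loop being the inverse of [a * c * b]. *)
Lemma mono_puncture : mono (a, c, b) puncture =
  wr (quad (c * c) (a * a) (b * b) (a * c * b * a * c * b)^-1) 1.
Proof.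
rewrite /puncture /mono !evM !evV evX evY.
apply: wr_eq => [|[j1 j2]]; first by rewrite ?wrE /= ?wrE.
case: (ord2P j1) => ->; case: (ord2P j2) => ->;
  rewrite ?wrE /= ?wrE /= ?wrE /= /quad ?ffunE /= ?conjgE ?gnorm.
all: by rewrite ?gnorm.
Qed.

Lemma mono_XX :
  (mono (a, c, b) (X * X)).2 = 1 /\ (mono (a, c, b) (X * X)).1 1 = a * c.
Proof. by rewrite /mono !evM !evX ?wrE /= ?wrE /= /quad ?ffunE. Qed.

Lemma mono_YY :
  (mono (a, c, b) (Y * Y)).2 = 1 /\ (mono (a, c, b) (Y * Y)).1 1 = c * b.
Proof. by rewrite /mono !evM !evY ?wrE /= ?wrE /= /quad ?ffunE. Qed.

End LocalMonodromy.

(** * Rigidity of twists acting as inner automorphisms *)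

Section Rigidity.
Variables (P : finGroupType) (A B : P).

Local Notation H := (wreath 'Z_3 P).

Definition pure (g : P) : H := wr [ffun=> 1] g.
Definition delta : {ffun P -> 'Z_3} := [ffun i => if i == 1 then Zp1 else 1].
(** The support of a conjugate of the middle entry records the image in [P] of the conjugator. In
    Z/3 this survives squaring, and the puncture shows only squares. *)
Definition triple0 : triple H := (pure A, wr delta 1, pure B).

(** A homomorphism to Z/3 that separates the base sheet: for [triple0] the four coordinates of the
    puncture have totals 2, 0, 0 and 1. *)
Definition total (u : H) : 'Z_3 := (\sum_(i : P) u.1 i)%R.

Lemma totalM u v : total (u * v) = (total u + total v)%R.
Proof.
rewrite /total; under eq_bigr => i _ do rewrite wrM1.
rewrite big_split /=; congr (_ + _)%R.
by rewrite [RHS](reindex_inj (mulIg u.2)).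
Qed.

Lemma total1 : total 1 = 0%R.
Proof. by rewrite /total big1 // => i _; rewrite wr11. Qed.

Lemma totalV u : total u^-1 = (- total u)%R.
Proof. by apply: (addrI (total u)); rewrite -totalM mulgV total1 subrr. Qed.

Lemma totalJ u v : total (u ^ v) = total u.
Proof. by rewrite conjgE !totalM totalV addrCA addNr addr0. Qed.

Lemma total_pure g : total (pure g) = 0%R.
Proof. by rewrite /total big1 // => i _; rewrite ffunE. Qed.

Lemma total_delta : total (wr delta 1) = 1%R.
Proof.
rewrite /total (bigD1 1) //= big1 ?addr0 ?ffunE ?eqxx //.
by move=> i /negPf ne_i1; rewrite ffunE ne_i1.
Qed.

Definition good_triple (h : triple H) : Prop :=
  let: (a, c, b) := h in
  [/\ a.2 = A, c.2 = 1, b.2 = B & [/\ total a = 0, total c = 1 & total b = 0]%R].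

Lemma good_triple0 : good_triple triple0.
Proof. by split=> //; split; rewrite ?total_pure ?total_delta. Qed.

(** Since [c] projects to 1, the conjugator lies over [A] or [B] or an inverse. The projections of
    [a], [c], [b] thus stay fixed, while [c] collects the letter. *)
Lemma good_braid1 l h : good_triple h -> good_triple (braid1 l h) /\
  exists d, (braid1 l h).1.2 = h.1.2 ^ d /\ d.2 = ev_letter A B l.
Proof.
case: h l => [[a c] b] [i e] [a2 c2 b2 [ta tc tb]].
rewrite /braid1 /ev_letter /=; case: ifP => _ /=.
  have d2 : (if e then (a * c)^-1 else a * c).2 = if e then A^-1 else A.
    by case: e; rewrite ?wrV2 wrM2 a2 c2 mulg1.
  split; last by exists (if e then (a * c)^-1 else a * c).
  split; rewrite ?wrJ2 ?d2 ?a2 ?c2 ?conj1g //; last by rewrite !totalJ.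
  1,2: by case: e {d2}; rewrite ?gnorm.
have d2 : (if e then (c * b)^-1 else c * b).2 = if e then B^-1 else B.
  by case: e; rewrite ?wrV2 wrM2 b2 c2 mul1g.
split; last by exists (if e then (c * b)^-1 else c * b).
split; rewrite ?wrJ2 ?d2 ?b2 ?c2 ?conj1g //; last by rewrite !totalJ.
1,2: by case: e {d2}; rewrite ?gnorm.
Qed.

Lemma good_braid s h : good_triple h -> good_triple (braid s h) /\
  exists d, (braid s h).1.2 = h.1.2 ^ d /\ d.2 = ev_word A B s.
Proof.
elim: s h => [|l s IHs] h good_h /=.
  by split=> //; exists 1; rewrite conjg1.
have [good1 [d1 [e1 d12]]] := good_braid1 l good_h.
have [good2 [d2 [e2 d22]]] := IHs _ good1; split=> //.
by exists (d1 * d2); rewrite e2 e1 conjgM wrM2 d12 d22.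
Qed.

(** The conjugate of [wr delta 1] by [m] is supported at [m.2] alone, and so is its square. *)
Lemma wr_conj_inj (m c : H) :
  wr delta 1 ^ m * wr delta 1 ^ m = wr delta 1 ^ c * wr delta 1 ^ c -> m.2 = c.2.
Proof.
rewrite -!conjMg => /(congr1 (fun u : H => u.1 m.2)).
have Z3J (x y : 'Z_3) : x ^ y = x by rewrite conjgE Zp_mulgC mulgK.
rewrite !wrJ1 //= ?mulg1 // mulgV !Z3J !ffunE !mulg1 eqxx.
case: eqP => [e _|_ /eqP //].
by apply: (mulIg c.2^-1); rewrite e mulgV.
Qed.

(* A twist acting as an inner automorphism must fix the puncture's class, and
   the conjugator carries the puncture to the same sheet of the covering with
   group [P] as the twist does. *)
Theorem twist_rigid s (m : wreath H V4) :
  (forall w, mono triple0 (twist s w) = mono triple0 w ^ m) ->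
  commute (ev_word A B s) A /\ commute (ev_word A B s) B.
Proof.
move=> twist_m; have [k [k1 mono_s]] := mono_twist s triple0.
have [] := good_braid s good_triple0.
case eq_s : (braid s triple0) => [[a c] b] [a2 c2 b2 [ta tc tb]] [d [/= cE d2]].
pose n := m * (wr k 1)^-1.
have mono_n w : mono (a, c, b) w = mono triple0 w ^ n.
  by rewrite conjgM -twist_m mono_s eq_s conjgK.
(* On the base sheet the braided triple gives the puncture total 2; conjugation by [n] reads it from
   sheet [n.2], and only the base sheet has this total. *)
clearbody n; have n2 : n.2 = 1.
  move: (mono_n puncture); rewrite !mono_puncture.
  move=> /(congr1 (fun u : wreath H V4 => total (u.1 1))).
  rewrite wrJ1 // mul1g invV4 totalJ /= /quad !ffunE /= totalM tc.
  case: (n.2) => i j; case: (ord2P i) => ->; case: (ord2P j) => -> //=;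
    by rewrite ?totalV !totalM !total_pure ?total_delta.
have at1 w : (mono triple0 w).2 = 1 ->
    (mono (a, c, b) w).1 1 = (mono triple0 w).1 1 ^ n.1 1.
  by move=> w2; rewrite mono_n wrJ1 // n2 invg1 mulg1.
have XX : a * c = (pure A * wr delta 1) ^ n.1 1.
  have [_ <-] := mono_XX a c b.
  by have [XX2 XX1] := mono_XX (pure A) (wr delta 1) (pure B); rewrite at1 // XX1.
have YY : c * b = (wr delta 1 * pure B) ^ n.1 1.
  have [_ <-] := mono_YY a c b.
  by have [YY2 YY1] := mono_YY (pure A) (wr delta 1) (pure B); rewrite at1 // YY1.
have ZZ : c * c = (wr delta 1 * wr delta 1) ^ n.1 1.
  have := at1 puncture; rewrite !mono_puncture.
  by rewrite /= /quad !ffunE /= => /(_ erefl).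
(* The square of [c] is a conjugate in two ways, by [d] and by [n.1 1], so these have the same image
   in [P]. *)
have p2 : (n.1 1).2 = ev_word A B s.
  by rewrite -d2; apply: wr_conj_inj; rewrite -cE ZZ conjMg.
have conjP (g : P) : g ^ ev_word A B s = g -> commute (ev_word A B s) g.
  by move=> gJ; rewrite /commute -{1}gJ conjgE mulVKg.
split; apply: conjP; rewrite -p2.
  move: (congr1 snd XX); rewrite wrJ2 !wrM2 a2 c2 /= mulg1.
  by move=> <-.
move: (congr1 snd YY); rewrite wrJ2 !wrM2 b2 c2 /= mul1g.
by move=> <-.
Qed.

End Rigidity.

Lemma ev_word_morph (G K : groupType) (f : G -> K) (u v : G) s :
  {morph f : x y / x * y} -> f (ev_word u v s) = ev_word (f u) (f v) s.
Proof.
move=> fM; have f1 : f 1 = 1 by apply: (mulgI (f 1)); rewrite -fM !mulg1.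
have fV x : f x^-1 = (f x)^-1 by apply: (mulgI (f x)); rewrite -fM !mulgV.
elim: s => [//|[i b] s IHs] /=; rewrite fM IHs /ev_letter /=.
by case: ifP; case: ifP; rewrite ?fV.
Qed.

(* In [Z/3 wr <A0>] an element commuting with [(delta; A0)] projects into
   [<A0>], and [(1; a)] has no nontrivial power commuting with [(delta; b)]. *)
Lemma rigid_cover (Q : finGroupType) (a b : Q) :
  exists (P : finGroupType) (A B : P), forall s,
    commute (ev_word A B s) A -> commute (ev_word A B s) B ->
    ev_word a b s = 1.
Proof.
pose P0 := wreath 'Z_3 Q.
pose A0 : P0 := pure a; pose B0 : P0 := wr (delta Q) b.
exists (wreath 'Z_3 P0), (wr (delta P0) A0), (pure B0) => s.
set p := ev_word _ _ s => pA pB.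
have p2 : p.2 = ev_word A0 B0 s by rewrite /p (ev_word_morph _ _ _ (@wrM2 _ _)).
have p22 : p.2.2 = ev_word a b s by rewrite p2 (ev_word_morph _ _ _ (@wrM2 _ _)).
(* Sum the coordinates of the relation with [(delta; A0)] over the subgroup generated by [A0]. The
   terms of [p] cancel, and [delta] contributes 1 on one side, so the other side must meet its
   support as well. *)
have pcyc : p.2 \in <[A0]>.
  have : (\sum_(i in <[A0]>) (p.1 i + delta P0 (i * p.2)%g)
        = \sum_(i in <[A0]>) (delta P0 i + p.1 (i * A0)%g))%R.
    apply: eq_bigr => i _; move: (congr1 (fun u : wreath 'Z_3 P0 => u.1 i) pA).
    by rewrite !wrM1.
  rewrite !big_split /= [RHS]addrC.
  rewrite [X in _ = (X + _)%R](_ : _ = \sum_(i in <[A0]>) p.1 i)%R.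
    move/addrI; have [//|notin] := boolP (p.2 \in <[A0]>).
    rewrite big1 => [|i iA]; last first.
      rewrite ffunE; case: eqP => // ip; case/negP: notin.
      by rewrite -groupV (_ : p.2^-1 = i) //; apply: (mulIg p.2); rewrite ip mulVg.
    rewrite (bigD1 1) ?group1 //= big1 ?addr0 ?ffunE ?eqxx //.
    by move=> i /andP[_ /negPf ne]; rewrite ffunE ne.
  rewrite [RHS](reindex_inj (mulIg A0)) /=; apply: eq_bigl => i.
  by rewrite groupMr // cycle_id.
have /cycleP[k pk] := pcyc.
have pureX : A0 ^+ k = pure (a ^+ k).
  elim: k {pk} => [//|k IHk]; rewrite !expgS IHk; apply: wr_eq => // i.
  by rewrite wrM1 !ffunE mulg1.
have ak : a ^+ k = 1.
  (* At coordinate 1 the relation reads [delta (a ^+ k) = delta 1]. *)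
  move: (congr1 (fun u : wreath 'Z_3 P0 => u.2.1 1) pB).
  rewrite !wrM2 pk pureX !wrM1 /= !ffunE !mul1g eqxx.
  by case: eqP.
by rewrite -p22 pk pureX.
Qed.

(** The permutation representation on left cosets: an element acting trivially fixes the coset [S],
    hence lies in [S], and a normal [S] acts trivially. *)
Lemma coset_representation (G : groupType) (S : groupClosed G) :
  finite_index S -> exists (Q : finGroupType) (rho : G -> Q),
    [/\ {morph rho : x y / x * y},
        forall g, rho g = 1 -> g \in S &
        (forall g k, g \in S -> g ^ k \in S) ->
        forall g, g \in S -> rho g = 1].
Proof.
move/finite_fsetP => [B eqB].
(* Translation by the inverse of [g], to match the left-to-right product of permutations. *)
pose shift (g : G) (c : set G) : set G := [set x | c (g * x)]%classic.
have shift_coset g k : shift g (left_coset S k) = left_coset S (g^-1 * k).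
  by apply/seteqP; split=> x; rewrite /shift /left_coset /= invgM invgK mulgA.
have shiftB g (c : set G) : c \in B -> shift g c \in B.
  move=> cB; have : [set` B]%classic c by [].
  rewrite -eqB => -[k _ <-]; rewrite shift_coset.
  suff : [set` B]%classic (left_coset S (g^-1 * k)) by [].
  by rewrite -eqB; exists (g^-1 * k).
pose f g (c : B) : B := [` shiftB g _ (valP c)]%fset.
have f_inj g : injective (f g).
  move=> c d /(congr1 val) /= /(congr1 (shift g^-1)) eq_cd; apply: val_inj.
  move: eq_cd; rewrite /shift /= => /seteqP[cd dc].
  apply/seteqP; split=> x cx.
    by have := cd x; rewrite /= mulVKg => /(_ cx).
  by have := dc x; rewrite /= mulVKg => /(_ cx).
pose rho g : {perm B} := perm (f_inj g).
have oneB : left_coset S 1 \in B.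
  suff : [set` B]%classic (left_coset S 1) by [].
  by rewrite -eqB; exists 1.
exists {perm B}, rho; split.
- move=> g h; apply/permP => c; rewrite permM !permE; apply: val_inj => /=.
  by apply/seteqP; split=> x; rewrite /shift /= mulgA.
- move=> g rho1; have := congr1 (fun s : {perm B} => val (s [` oneB]%fset)) rho1.
  rewrite perm1 permE /= shift_coset => /seteqP[_ /(_ 1)].
  rewrite /left_coset /= !gnorm.
  by apply; exact: gpred1.
- move=> normS g gS; apply/permP => c; rewrite perm1 permE; apply: val_inj => /=.
  have : [set` B]%classic (val c) by exact: valP.
  rewrite -eqB => -[k _ <-]; rewrite shift_coset.
  apply/seteqP; split=> x; rewrite /left_coset /= invgM invgK => xS.
    have -> : k^-1 * x = (g^-1) ^ k * (k^-1 * g * x).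
      by rewrite conjgE !mulgA ?gnorm.
    by rewrite gpredM // normS // gpredV.
  have -> : k^-1 * g * x = g ^ k * (k^-1 * x) by rewrite conjgE !mulgA mulgK.
  by rewrite gpredM // normS.
Qed.

(** * Transvections and the matrices of twists *)

Lemma transvection_subproof (i : 'I_2) (k : int) :
  (\det (\matrix_(r, c) (if r == c then 1 else if r == i then k else 0)
    : 'M[int]_2) == 1)%R.
Proof.
rewrite (expand_det_row _ ord0) !big_ord_recl big_ord0 /cofactor !det_mx11 !mxE /=.
by case: (ord2P i) => ->; rewrite /= ?mulr0 ?mul0r ?mulr1 ?mul1r.
Qed.

Definition transvection i k : SL2Z := MkSL2Z (transvection_subproof i k).

Lemma transvectionD i k l :
  transvection i (k + l)%R = transvection i k * transvection i l.
Proof.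
apply: val_inj; apply/matrixP => r c; rewrite !mxE !big_ord_recl big_ord0 !mxE.
case: (ord2P i) => ->; case: (ord2P r) => ->; case: (ord2P c) => -> /=; ring.
Qed.

Lemma transvection0 i : transvection i 0 = 1.
Proof.
apply: val_inj; apply/matrixP => r c; rewrite !mxE.
by case: (ord2P i) => ->; case: (ord2P r) => ->; case: (ord2P c) => -> /=.
Qed.

Lemma transvectionN i k : transvection i (- k)%R = (transvection i k)^-1.
Proof.
by apply: (mulgI (transvection i k)); rewrite -transvectionD subrr transvection0 mulgV.
Qed.

Definition twist_mx (s : seq letter) : SL2Z :=
  ev_word (transvection ord0 (- 2)) (transvection ord_max 2) s.

Lemma twist_mxE s i j : twist_mx s i j = expo i (twist s (gen j)).
Proof.
elim: s i => [|[k b] s IHs] i; first by rewrite /= !mxE expo_gen.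
rewrite /= expo_twist1 -!IHs /twist_mx /= !mxE !big_ord_recl big_ord0.
rewrite (_ : lift _ _ = ord_max); last exact: val_inj.
rewrite /ev_letter /=; case: (ord2P k) => -> /=; case: b;
  rewrite -?transvectionN /= !mxE; case: (ord2P i) => -> /=; ring.
Qed.

Lemma aut_generates (a : autF2) : generates (a X) (a Y).
Proof.
move=> w; have [b _ bK] := aut_bij a; exists (b w).
by rewrite -hom_ev bK.
Qed.

Lemma sanov_conj g u v : sanov (u ^ g) (v ^ g) = sanov u v.
Proof. by rewrite /sanov !expo_conj. Qed.

(** * Detection of a finite index subgroup by a finite quotient *)

Section Detection.
Variables (P : finGroupType) (A B : P).

Definition detector_type : finGroupType :=
  (wreath (wreath 'Z_3 P) V4 * ('I_4 * 'I_4))%type.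

Definition detector (w : F2) : detector_type :=
  (mono (triple0 A B) w,
   ((expo ord0 w)%:~R%R : 'I_4, (expo ord_max w)%:~R%R : 'I_4)).

Lemma detectorM : {morph detector : u v / u * v}.
Proof.
move=> u v; congr (_, _); first exact: monoM.
by rewrite !expoM !rmorphD.
Qed.

HB.instance Definition _ :=
  isMultiplicative.Build F2 detector_type detector detectorM.

(** The exponents modulo 4 lie in an abelian group, so [a] is trivial modulo 4. Its normal form then
    has the representative [(X, Y)], so [a] is a twist up to conjugation, to which rigidity
    applies. *)
Lemma detector_conj (a : autF2) : 
  (exists u, forall w, detector (a w) = detector w ^ detector u) ->
  exists s, (forall i j, ab_mx a i j = twist_mx s i j) /\
    commute (ev_word A B s) A /\ commute (ev_word A B s) B.
Proof.
case=> u a_u.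
have expo_a w i : ((expo i (a w))%:~R = (expo i w)%:~R :> 'I_4)%R.
  move: (a_u w) => /(congr1 snd).
  rewrite -[snd (_ ^ _)]/((detector w).2 ^ (detector u).2).
  have I4J (x y : 'I_4) : x ^ y = x by rewrite conjgE Zp_mulgC mulgK.
  have -> (x y : 'I_4 * 'I_4) : x ^ y = x.
    by case: x y => x1 x2 [y1 y2]; congr (_, _); exact: I4J.
  by case=> e0 e1; case: (ord2P i) => ->.
have [s [g [t [tT aX aY]]]] := generates_normal_form (aut_generates a).
have dvd4 (m n : int) : (m%:~R = n%:~R :> 'I_4)%R -> (4 %| (m - n)%R)%Z.
  move/eqP; rewrite -subr_eq0 -rmorphB /= {1}(divz_eq (m - n) 4) rmorphD rmorphM /=.
  rewrite (_ : 4%:~R = 0 :> 'I_4)%R ?mulr0 ?add0r; last exact: val_inj.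
  have := modz_ge0 (m - n)%R (isT : 4 != 0 :> int)%R.
  move=> r_ge0 r0; apply/dvdz_mod0P; move: r_ge0 r0.
  case: (_ %% _)%Z (ltz_pmod (m - n)%R (isT : 0 < 4 :> int)%R) => // r r4 _.
  by case: r r4 => [|[|[|[|]]]].
have tE : t = (X, Y).
  apply: sanov_coset_reps tT _; apply: (sanov_twist (s := s)).
  rewrite -(sanov_conj g) -aX -aY.
  have := dvd4 _ _ (expo_a X ord0); have := dvd4 _ _ (expo_a X ord_max).
  have := dvd4 _ _ (expo_a Y ord0); have := dvd4 _ _ (expo_a Y ord_max).
  by rewrite !expo_gen /= !subr0; split=> //; lia.
rewrite tE /= in aX aY; have aE w : a w = twist s w ^ g.
  have := hom_ext (f := a) (g := conj_by g \o twist s).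
  by rewrite /= /conj_by aX aY => ->.
exists s; split; first by move=> i j; rewrite twist_mxE mxE aE expo_conj.
(* The factor [g^-1] undoes the conjugation relating [a] to [twist s]. *)
apply: (twist_rigid (m := mono (triple0 A B) (u * g^-1))) => w.
rewrite gmulfM conjgM mulfV.
move: (a_u w) => /(congr1 fst).
rewrite -[fst (_ ^ _)]/((detector w).1 ^ (detector u).1) /= => <-.
by rewrite aE mulfJ conjgK.
Qed.

End Detection.

Theorem detecting_hom (Gamma : groupClosed SL2Z) : finite_index Gamma ->
  exists (T : finGroupType) (f : {multiplicative F2 -> T}),
    forall (a : autF2) (g : SL2Z), ab_mx a = g ->
      (exists u, forall w, f (a w) = f w ^ f u) -> g \in Gamma.
Proof.
move=> /coset_representation [Q [rho [rhoM rho1 _]]].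
have [P [A [B rigid]]] := rigid_cover (rho (transvection ord0 (- 2)))
  (rho (transvection ord_max 2)).
exists (detector_type P), (detector A B) => a g ag.
move=> /detector_conj[s [as_ [cA cB]]]; apply: rho1.
have -> : g = twist_mx s by apply: val_inj; apply/matrixP => i j; rewrite /= -ag as_.
by rewrite /twist_mx (ev_word_morph _ _ _ rhoM) rigid.
Qed.

(** * Lifting SL2(Z) to automorphisms *)

Lemma SL2Z_mulE (g h : SL2Z) (i j : 'I_2) :
  ((g * h)%g i j = g i ord0 * h ord0 j + g i ord_max * h ord_max j)%R.
Proof.
rewrite mxE !big_ord_recl big_ord0 addr0.
by rewrite (_ : lift _ _ = ord_max) //; apply: val_inj.
Qed.

Lemma SL2Z_eq (g h : SL2Z) :
  g ord0 ord0 = h ord0 ord0 -> g ord0 ord_max = h ord0 ord_max ->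
  g ord_max ord0 = h ord_max ord0 -> g ord_max ord_max = h ord_max ord_max ->
  g = h.
Proof.
move=> e00 e01 e10 e11; apply: val_inj; apply/matrixP => i j.
by case: (ord2P i) => ->; case: (ord2P j) => ->.
Qed.

Lemma SL2Z_detE (g : SL2Z) :
  (g ord0 ord0 * g ord_max ord_max - g ord0 ord_max * g ord_max ord0 = 1)%R.
Proof.
rewrite -[RHS](SL2Z_det2 g).
by congr (_ * _ - _ * _)%R; congr (SL2Z_mx g _ _); apply: val_inj.
Qed.

Lemma transvectionE i k r c :
  transvection i k r c = (if r == c then 1 else if r == i then k else 0)%R.
Proof. exact: mxE. Qed.

Definition weyl : SL2Z :=
  transvection ord0 1 * transvection ord_max (- 1) * transvection ord0 1.

(** The Euclidean algorithm on the first column, by induction on the absolute value of the lower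
    left entry. *)
Lemma SL2Z_ind (S : SL2Z -> Prop) :
  (forall g h, S g -> S h -> S (g * h)) -> (forall i k, S (transvection i k)) ->
  forall g, S g.
Proof.
move=> SM St; have Sw : S weyl := SM _ _ (SM _ _ (St _ _) (St _ _)) (St _ _).
have Sww : S (weyl * weyl) by exact: SM.
move=> g; have [n] := ubnP `|g ord_max ord0|%N; elim: n g => // n IHn g lt_n.
have [c0|c_neq0] := eqVneq (g ord_max ord0) 0%R.
  have := SL2Z_detE g; rewrite c0 mulr0 subr0.
  have [a1|a1] : (g ord0 ord0 = 1 \/ g ord0 ord0 = -1)%R.
    have := SL2Z_detE g; rewrite c0 mulr0 subr0.
    move/(congr1 absz); rewrite abszM => /eqP; rewrite muln_eq1 => /andP[/eqP a1 _].
    lia.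
  - rewrite a1 mul1r => d1; rewrite (_ : g = transvection ord0 (g ord0 ord_max)) //.
    by apply: SL2Z_eq; rewrite transvectionE.
  - rewrite a1 mulN1r => d1.
    rewrite (_ : g = weyl * weyl * transvection ord0 (- g ord0 ord_max)%R).
      exact: SM.
    by apply: SL2Z_eq; rewrite /weyl !SL2Z_mulE !transvectionE /=; lia.
pose q := (g ord0 ord0 %/ g ord_max ord0)%Z.
(* The inverse of [weyl] is written as its cube because [S] is only closed under products. The last
   factor has the remainder of the division, up to sign, as its lower left entry. *)
have -> : g = transvection ord0 q * (weyl * weyl) * weyl *
    (weyl * transvection ord0 (- q)%R * g).
  have w4 : weyl * weyl * (weyl * weyl) = 1.
    by apply: SL2Z_eq; rewrite /weyl !SL2Z_mulE !transvectionE ?mxE /=.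
  rewrite transvectionN.
  transitivity (transvection ord0 q * (weyl * weyl * (weyl * weyl))
      * (transvection ord0 q)^-1 * g); last by rewrite !mulgA.
  by rewrite w4 mulg1 mulgV mul1g.
apply: (SM _ _ (SM _ _ (SM _ _ (St _ _) Sww) Sw)).
apply: IHn; rewrite /weyl !SL2Z_mulE !transvectionE /=.
have := modz_ge0 (g ord0 ord0) c_neq0; have := ltz_mod (g ord0 ord0) c_neq0.
have := divz_eq (g ord0 ord0) (g ord_max ord0); rewrite -/q.
lia.
Qed.

Lemma cancel_ev (u v u' v' : F2) : ev u' v' u = X -> ev u' v' v = Y ->
  cancel (ev u v) (ev u' v').
Proof.
move=> eX eY w; rewrite -[RHS]/(idfun w).
by apply: (hom_ext (f := ev u' v' \o ev u v)); rewrite /= ?evX ?evY.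
Qed.

Lemma lift_transvection i : exists a : autF2, ab_mx a = transvection i 1.
Proof.
(* The flag [b] selects the inverse automorphism. *)
pose u b := if i == ord0 then X else (if b then Y^-1 else Y) * X.
pose v b := if i == ord0 then (if b then X^-1 else X) * Y else Y.
have uvK b : cancel (ev (u b) (v b)) (ev (u (~~ b)) (v (~~ b))).
  apply: cancel_ev; rewrite /u /v; case: (ord2P i) => ->; case: b => /=;
    by rewrite ?evM ?evV ?evX ?evY ?gnorm.
have uv_bij : bijective (ev (u false) (v false)).
  by exists (ev (u true) (v true)); [exact: uvK | exact: (uvK true)].
exists (AutF2 (aut_fun := ev (u false) (v false)) uv_bij).
apply/matrixP => r c; rewrite !mxE /= /u /v.
by case: (ord2P i) => ->; case: (ord2P r) => ->; case: (ord2P c) => -> /=;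
  rewrite ?evX ?evY ?expoM ?expo_gen.
Qed.

Lemma ab_mx_inv (a b : autF2) (g : SL2Z) :
  cancel b a -> ab_mx a = g -> ab_mx b = g^-1%g.
Proof.
move=> bK ag; have : (ab_mx a *m ab_mx b = 1%:M)%R.
  by rewrite -ab_mx_comp -ab_mx_id; apply/matrixP => i j; rewrite !mxE /= bK.
by rewrite ag => /(congr1 (mulmx (invmx g))); rewrite mulmx1 mulKmx ?SL2Z_unit.
Qed.

Lemma lift_SL2Z (g : SL2Z) : exists a : autF2, ab_mx a = g.
Proof.
have LM (k h : SL2Z) : (exists a : autF2, ab_mx a = k) ->
    (exists a : autF2, ab_mx a = h) -> exists a : autF2, ab_mx a = (k * h)%g.
  by move=> [a ak] [b bh]; exists (aut_comp a b); rewrite ab_mx_comp ak bh.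
have LV (k : SL2Z) : (exists a : autF2, ab_mx a = k) ->
    exists a : autF2, ab_mx a = k^-1%g.
  by move=> [a ak]; have [b [_ bK]] := aut_has_inv a; exists b; exact: ab_mx_inv bK ak.
apply: (SL2Z_ind (S := fun g => exists a : autF2, ab_mx a = g)) g => // i k.
have Lnat (n : nat) : exists a : autF2, ab_mx a = transvection i n.
  elim: n => [|n IHn]; first by exists aut_id; rewrite transvection0 ab_mx_id.
  have -> : Posz n.+1 = (n%:Z + 1)%R by lia.
  by rewrite transvectionD; apply: LM IHn (lift_transvection i).
case: k => n; first exact: Lnat.
by rewrite NegzE transvectionN; apply: LV; exact: Lnat.
Qed.

(** * Stabilizers of exterior surjections *)

(** Restricting the target to the image of [f] makes every conjugating element a value [f u]. *)
Lemma image_surjection (T : finGroupType) (f : {multiplicative F2 -> T}) :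
  exists (G : finGroupType) (phi : surjF2 G), forall g : SL2Z,
    g \in ext_stab (ext_class phi) <->
    exists2 a : autF2, ab_mx a = g & exists u, forall w, f (a w) = f w ^ f u.
Proof.
pose I := [set x : T | `[< exists w, f w = x >]].
have I_group : group_set I.
  apply/group_setP; split; first by rewrite inE; apply/asboolP; exists 1; exact: mulf1.
  move=> x y; rewrite inE => /asboolP[u <-]; rewrite inE => /asboolP[v <-].
  rewrite inE; apply/asboolP; exists (u * v); exact: gmulfM.
pose IG := Group I_group.
have fI w : f w \in IG by rewrite inE; apply/asboolP; exists w.
pose h w : subg_of IG := subg IG (f w).
have hM : {morph h : u v / u * v} by move=> u v; rewrite /h gmulfM subgM.
pose hmul := isMultiplicative.Build F2 (subg_of IG) h hM.
pose h' : {multiplicative F2 -> subg_of IG} := HB.pack h hmul.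
have h_onto (x : subg_of IG) : exists w, h' w = x.
  have := subgP x; rewrite inE => /asboolP[w fw]; exists w.
  by rewrite /= /h fw sgvalK.
exists (subg_of IG), (SurjF2 h_onto) => g.
have fE w : f w = sgval (h w) by rewrite subgK.
have sgvalJ (x y : subg_of IG) : sgval (x ^ y) = sgval x ^ sgval y by [].
split.
  case/ext_stabP => a ag [x hx]; exists a => //.
  have [u hu] := h_onto x; exists u => w.
  by rewrite !fE -sgvalJ; congr sgval; rewrite /= in hx hu; rewrite hx -hu conjgE mulgA.
case=> a ag [u fu]; apply/ext_stabP; exists a => //; exists (h u) => w.
apply: val_inj; rewrite /= -mulgA -conjgE.
have := fu w; rewrite !fE -sgvalJ.
by [].
Qed.

Section CharacteristicKernel.
Variables (T : finGroupType) (f : {multiplicative F2 -> T}).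

(** A homomorphism to [T] is indexed by the images of the two generators; the base of a wreath
    product serves as the direct power of [T]. *)
Definition all_homs (w : F2) : wreath T (T * T)%type :=
  wr [ffun p => ev p.1 p.2 w] 1.

Lemma all_homsM : {morph all_homs : u v / u * v}.
Proof.
move=> u v; apply: wr_eq => [|p]; first by rewrite wrM2 mulg1.
by rewrite wrM1 /= !ffunE mulg1 evM.
Qed.

HB.instance Definition _ :=
  isMultiplicative.Build F2 (wreath T (T * T)%type) all_homs all_homsM.

Lemma all_homs_conj (a : autF2) u :
  (forall w, all_homs (a w) = all_homs w ^ all_homs u) <->
  (forall (h : {multiplicative F2 -> T}) w, h (a w) = h (w ^ u)).
Proof.
split=> [au h w | au w].
  have := congr1 (fun x : wreath T (T * T)%type => x.1 (h X, h Y)) (au w).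
  rewrite wrJ1 //= invg1 mulg1 !ffunE /= -!hom_ev => ->.
  by rewrite mulfJ.
apply: wr_eq => [|p]; first by rewrite wrJ2 conj1g.
by rewrite wrJ1 //= invg1 mulg1 !ffunE (au (ev p.1 p.2)) mulfJ.
Qed.

End CharacteristicKernel.

(* Replacing a homomorphism by the product of all homomorphisms to the same
   finite group makes its kernel characteristic and its stabilizer normal. *)
Lemma normal_stabilizer (T : finGroupType) (f : {multiplicative F2 -> T}) :
  exists (G : finGroupType) (phi : surjF2 G),
    let N := ext_stab (ext_class phi) in
    [/\ forall g : SL2Z, g \in N -> exists2 a : autF2, ab_mx a = g &
          exists u, forall w, f (a w) = f w ^ f u,
        forall g k : SL2Z, g \in N -> g ^ k \in N &
        finite_set (range (left_coset N))].
Proof.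
have [G [phi phiP]] := image_surjection (all_homs T).
exists G, phi => N.
have NP (g : SL2Z) : g \in N <-> exists2 a : autF2, ab_mx a = g &
    exists u, forall (h : {multiplicative F2 -> T}) w, h (a w) = h (w ^ u).
  rewrite /N phiP; split=> -[a ag [u au]]; exists a => //; exists u.
    exact/all_homs_conj.
  exact/all_homs_conj.
split.
- move=> g /NP[a ag [u au]]; exists a => //; exists u => w.
  by rewrite au mulfJ.
- move=> g k /NP[a ag [u au]]; apply/NP.
  have [b bk] := lift_SL2Z k; have [b' [bK b'K]] := aut_has_inv b.
  exists (aut_comp b' (aut_comp a b)).
    by rewrite !ab_mx_comp ag bk (ab_mx_inv b'K bk).
  (* The condition on [a] ranges over all homomorphisms, so it applies to [h \o b']. *)
  exists (b' u) => h w /=; rewrite -[h (b' _)]/((h \o b') _) au /=.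
  by rewrite mulfJ bK.
have [lift liftE] := choice lift_SL2Z.
(* A lift of [g] permutes the finitely many homomorphisms to [T], and this permutation determines
   the coset of [g]. *)
pose e g : {ffun T * T -> T * T} :=
  [ffun p => (ev p.1 p.2 (lift g X), ev p.1 p.2 (lift g Y))].
have e_inj g k : e g = e k -> left_coset N g = left_coset N k.
  move=> /ffunP e_gk.
  have lift_gk (h : {multiplicative F2 -> T}) w : h (lift g w) = h (lift k w).
    apply: (hom_ext (f := h \o lift g) (g := h \o lift k)) => /=;
      by have := e_gk (h X, h Y); rewrite !ffunE /= -!hom_ev => -[].
  have gkN : g^-1 * k \in N.
    apply/NP; have [b' [bK b'K]] := aut_has_inv (lift g).
    exists (aut_comp b' (lift k)).
      by rewrite ab_mx_comp (ab_mx_inv b'K (liftE g)) liftE.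
    exists 1 => h w; rewrite conjg1 /= -[h (b' _)]/((h \o b') _) -lift_gk /=.
    by rewrite bK.
  apply/seteqP; split=> x; rewrite /left_coset /= => xN.
    by rewrite -[x](mulVKg g) mulgA -[k^-1 * g]invgK invgM invgK gpredM // gpredV.
  by rewrite -[x](mulVKg k) mulgA gpredM.
(* On a value of [e] the choice gives some element inducing it; elsewhere the default 1 merely adds
   the coset of 1. *)
pose F c := left_coset N (xget 1 [set g | e g = c]%classic).
apply: (sub_finite_set (B := F @` setT)); last exact/finite_image/finite_finset.
move=> _ [g _ <-]; exists (e g) => //; apply: e_inj.
exact: (xgetPex 1 (ex_intro (fun k => e k = e g) g erefl)).
Qed.

(** * Quotients of modular curves *)

Section Curves.
Local Open Scope classical_set_scope.
Local Open Scope ring_scope.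
Variable R : realType.

Local Notation C := ((R[i])^o).
Local Notation UHP := (UHP R).

Lemma valL_UHP (F : UHP -> C) (z : UHP) : valL_ (0 : C) F (val z) = F z.
Proof. exact: (congr1 (@^~ z) (valLK (0 : C) F)). Qed.

(** The disc around [z] of radius the imaginary part of [z] stays in the half plane. *)
Lemma near_UHP (z : UHP) :
  \forall c \near (val z : C), 0 < complex.Im (c : R[i]).
Proof.
have z0 := UHP_im z; apply/nbhs_ballP.
exists ((complex.Im (val z : R[i]))%:C%C : R[i]); first by rewrite /= ltcR.
move=> c; rewrite /ball /=; case: (sval z) c z0 => [x1 y1] [x2 y2] /= z0.
rewrite normc_def ltcR /= => lt_y; have : y1 - y2 < y1; last by lra.
apply: le_lt_trans lt_y; apply: (le_trans (ler_norm _)).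
by rewrite -sqrtr_sqr ler_sqrt ?lerDr ?sqr_ge0 // addr_ge0 ?sqr_ge0.
Qed.

Definition mobius_map (g : SL2Z) (c : C) : C :=
  mobius_num g c / mobius_den g c.

Lemma derivable_mobius_map (g : SL2Z) (z : UHP) :
  derivable (mobius_map g) (val z) 1.
Proof.
have lin (a b : C) : derivable (fun c : C => a * c + b) (val z) 1.
  apply: derivableD; last exact: derivable_cst.
  by apply: derivableM; [exact: derivable_cst | exact: derivable_id].
rewrite (_ : mobius_map g = (fun c : C => mobius_num g c : C) *
  (fun c => (mobius_den g c : C)^-1)) //.
apply: derivableM; first exact: lin.
apply: derivableV; last exact: lin.
exact/mobius_den_neq0/UHP_im.
Qed.

Lemma continuous_mobius (g : SL2Z) : continuous (mobius g : UHP -> UHP).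
Proof.
apply: continuous_comp_initial => z.
have /derivable1_diffP/differentiable_continuous := @derivable_mobius_map g z.
apply: (continuous_comp (f := val : UHP -> C) (g := mobius_map g)).
exact: initial_continuous.
Qed.

(** The chain rule, applied to extensions by 0: near [z] the extension of the composite is the
    composite with [mobius_map g]. *)
Lemma holomorphic_mobius (F : UHP -> C) (g : SL2Z) (z : UHP) :
  holomorphic_at F (mobius g z) -> holomorphic_at (F \o mobius g) z.
Proof.
rewrite /holomorphic_at => dF.
have := @derivable_mobius_map g z => /derivable1_diffP dm.
move: dF; rewrite val_mobius => /derivable1_diffP dF.
have /derivable1_diffP := differentiable_comp dm dF.
apply: near_eq_derivable; near=> c.
have c0 : 0 < complex.Im (c : R[i]) by near: c; exact: near_UHP.
pose w : UHP := exist _ (c : C) (mem_set c0).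
suff /(_ w) : forall w : UHP, (valL_ 0 F \o mobius_map g) (val w)
    = valL_ (0 : C) (F \o mobius g) (val w) by [].
by move=> {}w; rewrite valL_UHP [RHS]/= -(valL_UHP F) val_mobius.
Unshelve. all: by end_near.
Qed.

End Curves.

Section CurveQuotient.
Variable R : realType.
Local Notation UHP := (UHP R).
Local Open Scope group_scope.

Lemma curve_proj_surj (S : groupClosed SL2Z) (x : curve_points R S) :
  exists z : UHP, curve_proj S z = x.
Proof. by exists (generic_quotient.repr x); exact: generic_quotient.reprK. Qed.

Lemma curve_continuous (S : groupClosed SL2Z) (Z : topologicalType)
  (f : curve_points R S -> Z) : continuous (f \o curve_proj S) -> continuous f.
Proof. by move=> cf; apply/quotient_continuous. Qed.

Lemma curve_open (S : groupClosed SL2Z) (V : set (curve_points R S)) :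
  open V <-> open (curve_proj S @^-1` V)%classic.
Proof. by []. Qed.

Definition curve_map (S S' : groupClosed SL2Z) (g : SL2Z)
    (x : curve_points R S) : curve_points R S' :=
  curve_proj S' (mobius g (generic_quotient.repr x)).

(** Moving [z] by [k] moves its image under [g] by [k ^ g^-1], so the orbit of the image is
    independent of the representative. *)
Lemma curve_mapE (S S' : groupClosed SL2Z) (g : SL2Z) (z : UHP) :
  (forall k, k \in S -> k ^ g^-1 \in S') ->
  curve_map S' g (curve_proj S z) = curve_proj S' (mobius g z).
Proof.
move=> Sg; rewrite /curve_map.
have : curve_proj S (generic_quotient.repr (curve_proj S z)) = curve_proj S z.
  exact: generic_quotient.reprK.
move: (generic_quotient.repr _) => r.
move/curve_projP => [k kS ->]; apply/curve_projP.
exists (k ^ g^-1); first exact: Sg.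
by rewrite -!mobiusM conjgE invgK mulgA mulgVK.
Qed.

Lemma holomorphic_curve_map (S : groupClosed SL2Z) (g : SL2Z) :
  (forall k, k \in S -> k ^ g^-1 \in S) ->
  @holomorphic_map R (modular_curve R S) (modular_curve R S) (curve_map S g).
Proof.
move=> Sg; split.
  apply: curve_continuous.
  rewrite (_ : _ \o _ = curve_proj S \o mobius g); last first.
    by apply/funext => z; exact: curve_mapE.
  move=> z; apply: continuous_comp; first exact: continuous_mobius.
  exact: pi_continuous.
move=> V u _ uV z /=; rewrite curve_mapE // => /uV /holomorphic_mobius.
have -> : (u \o curve_map S g) \o curve_proj S = (u \o curve_proj S) \o mobius g.
  by apply/funext => w /=; rewrite curve_mapE.
by [].
Qed.

(** The finite group is the image of [Gamma] in the permutations of the cosets of [N]. It acts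
    through lifts to [Gamma], and its orbits are the fibres of the projection. *)
Theorem normal_curve_quotient (N Gamma : groupClosed SL2Z) :
  {subset N <= Gamma} -> (forall g k : SL2Z, g \in N -> g ^ k \in N) ->
  finite_index N ->
  exists p : modular_curve R N -> modular_curve R Gamma,
    (forall z : UHP, p (curve_proj N z) = curve_proj Gamma z) /\
    finite_group_quotient p.
Proof.
move=> subN normN finN.
have [Q [rho [rhoM rho1 N_rho]]] := coset_representation finN.
have rho11 : rho 1 = 1 by apply: (mulgI (rho 1)); rewrite -rhoM !mulg1.
have rhoV g : rho g^-1 = (rho g)^-1.
  by apply: (mulgI (rho g)); rewrite -rhoM !mulgV.
pose I := [set q : Q | `[< exists2 g, g \in Gamma & rho g = q >]]%g.
have I_group : group_set I.
  apply/group_setP; split.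
    by rewrite inE; apply/asboolP; exists 1 => //; exact: gpred1.
  move=> q r; rewrite inE => /asboolP[g gG <-]; rewrite inE => /asboolP[h hG <-].
  by rewrite inE; apply/asboolP; exists (g * h); [exact: gpredM | exact: rhoM].
pose IG := Group I_group.
have /choice[lift liftP] (q : subg_of IG) :
    exists g, g \in Gamma /\ rho g = sgval q.
  by have := subgP q; rewrite inE => /asboolP[g gG rg]; exists g.
(* MathComp actions are right actions, whence the inverse. *)
pose act (x : modular_curve R N) (q : subg_of IG) : modular_curve R N :=
  curve_map N (lift q)^-1 x.
have mapN g z : curve_map N g (curve_proj N z) = curve_proj N (mobius g z).
  by apply: curve_mapE => k kN; exact: normN.
(* Two lifts of the same element differ by [N], so the action does not depend on the lift. *)
have rho_eq g h z : rho g = rho h ->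
    curve_proj N (mobius g^-1 z) = curve_proj N (mobius h^-1 z).
  move=> gh; apply/curve_projP; exists (h^-1 * g).
    by apply: rho1; rewrite rhoM rhoV gh mulVg.
  by rewrite -mobiusM mulgK.
have actE q z g : rho g = sgval q ->
    act (curve_proj N z) q = curve_proj N (mobius g^-1 z).
  move=> gq; rewrite /act mapN; apply: rho_eq.
  by rewrite gq; case: (liftP q).
have act1 : act^~ 1 =1 id.
  move=> x; have [z <-] := curve_proj_surj x.
  by rewrite (@actE _ _ 1) ?invg1 ?mobius1.
have actM x : act_morph act x.
  move=> q r; have [z <-] := curve_proj_surj x.
  rewrite (@actE q z (lift q)); last by case: (liftP q).
  rewrite (@actE r _ (lift r)); last by case: (liftP r).
  rewrite (@actE _ _ (lift q * lift r)) ?invgM ?mobiusM //.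
  by rewrite rhoM; case: (liftP q) => _ ->; case: (liftP r) => _ ->.
pose to : {action (subg_of IG) &-> (modular_curve R N)} := TotalAction act1 actM.
pose p : modular_curve R N -> modular_curve R Gamma := curve_map Gamma 1.
have pE z : p (curve_proj N z) = curve_proj Gamma z.
  rewrite /p curve_mapE ?mobius1 // => k kN.
  by rewrite invg1 conjg1; exact: subN.
exists p; split=> //; exists (subg_of IG), to; split.
- by move=> q; apply: holomorphic_curve_map => k kN; exact: normN.
- by move=> y; have [z <-] := curve_proj_surj y; exists (curve_proj N z).
- move=> x x'; have [z <-] := curve_proj_surj x; have [z' <-] := curve_proj_surj x'.
  rewrite !pE; split.
    move/curve_projP => [g gG ->].
    have gI : rho g^-1 \in IG.
      by rewrite inE; apply/asboolP; exists g^-1; rewrite ?gpredV.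
    exists (subg IG (rho g^-1)).
    by rewrite /= (@actE _ _ g^-1) ?invgK ?subgK.
  case=> q; rewrite /= (@actE _ _ (lift q)); last by case: (liftP q).
  move/(congr1 p); rewrite !pE => <-; apply/curve_projP; exists (lift q)^-1 => //.
  by rewrite gpredV; case: (liftP q).
(* Open sets and holomorphic functions on both curves are tested on the half plane, where the two
   pullbacks coincide by [pE]. *)
- move=> V; rewrite /= curve_open (curve_open (S := N)).
  rewrite (_ : curve_proj N @^-1` _ = curve_proj Gamma @^-1` V)%classic //.
  by apply/funext => z; rewrite /preimage /= pE.
- move=> V u _; rewrite /hol /=.
  have uE : (u \o p) \o curve_proj N = u \o curve_proj Gamma.
    by apply/funext => z /=; rewrite pE.
  split=> uV z Vz.
    by rewrite uE; apply: uV; rewrite -pE.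
  by rewrite -uE; apply: uV; rewrite /preimage /= pE.
Qed.

End CurveQuotient.

Local Close Scope group_scope.

Theorem corollary3p4p2 (R : realType) (Gamma : groupClosed SL2Z)
    (fin_Gamma : finite_index Gamma) :
  (exists (G : finGroupType) (phi : surjF2 G),
     {subset ext_stab (ext_class phi) <= Gamma}) /\
  (exists (G : finGroupType) (phi : surjF2 G)
     (p : modular_curve R (ext_stab (ext_class phi)) -> modular_curve R Gamma),
     (forall z : UHP R, p (curve_proj (ext_stab (ext_class phi)) z)
                        = curve_proj Gamma z) /\
     finite_group_quotient p).
Proof.
(* One surjection serves both halves: its stabilizer lies in [Gamma] by detection, and is normal of
   finite index by construction. *)
have [T [f fP]] := detecting_hom fin_Gamma.
have [G [phi [NT normN finN]]] := normal_stabilizer f.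
have subN : {subset ext_stab (ext_class phi) <= Gamma}.
  by move=> g /NT[a ag a_inner]; exact: fP ag a_inner.
split; exists G, phi => //.
exact: normal_curve_quotient.
Qed.
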